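(* Let $p>1$ and let $\gamma$ be a nontrivial (i.e. not identically zero) multiplicative linear functional on $F^p$. Then there exists $\lambda\in\mathbb{D}$ such that $\gamma(f)=f(\lambda)$ for every $f\in F^p$. Moreover, $\gamma$ is continuous on $F^p$.
   Context: $\mathbb{D}$ denotes the open unit disk in $\mathbb{C}$. For $p>1$, $F^p$ is the space of all holomorphic functions $f$ on $\mathbb{D}$ such that $\lim_{r\to 1^-}(1-r)^{1/p}\log^+M_\infty(r,f)=0$, where $M_\infty(r,f)=\max_{|z|\le r}|f(z)|$ for $0<r<1$ and $\log^+x=\max\{\log x,0\}$. For $f(z)=\sum_{n\ge0}a_nz^n\in F^p$ and $c>0$ one has $\|f\|_{p,c}:=\sum_{n=0}^\infty |a_n|\exp(-c\,n^{1/(p+1)})<\infty$, and $F^p$ carries the locally convex topology given by the family of seminorms $\{\|\cdot\|_{p,c}\}_{c>0}$; with this topology and pointwise multiplication, $F^p$ is a Fréchet algebra. A multiplicative linear functional is a linear map $\gamma:F^p\to\mathbb{C}$ with $\gamma(fg)=\gamma(f)\gamma(g)$ for all $f,g\in F^p$. *)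

(* Defs.v *)
From Stdlib Require Import Reals List ClassicalEpsilon.
From Coquelicot Require Import Coquelicot.
Open Scope R_scope.

Definition Disk : Type := {z : C | Cmod z < 1}.

Definition disk_val (z : Disk) : C := proj1_sig z.
Coercion disk_val : Disk >-> C.

(* Extension by 0 to the plane. As the disk is open, differentiability at a
   point of the disk does not depend on the values outside. *)
Definition extend (f : Disk -> C) (z : C) : C :=
  match Rlt_dec (Cmod z) 1 with
  | left h => f (exist _ z h)
  | right _ => RtoC 0
  end.

(* The derivative is the complex one: [C] is here a normed module over itself,
   not over the reals. *)
Definition holomorphic (f : Disk -> C) : Prop :=
  forall z : Disk, @ex_derive C_AbsRing C_NormedModule (extend f) (disk_val z).

(* [ln 0 = 0] in the library, so [log_plus 0 = 0] as it should. *)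
Definition log_plus (x : R) : R := Rmax (ln x) 0.

(* For [0 < r < 1] and [f] continuous (in particular, holomorphic) the
   supremum is finite and attained, i.e. it is the maximum. *)
Definition M_infty (r : R) (f : Disk -> C) : R :=
  real (Lub_Rbar (fun x => exists z : Disk, Cmod z <= r /\ x = Cmod (f z))).

Definition in_Fp (p : R) (f : Disk -> C) : Prop :=
  holomorphic f /\
  filterlim (fun r => Rpower (1 - r) (1 / p) * log_plus (M_infty r f))
            (at_left 1) (locally 0).

Definition fplus (f g : Disk -> C) : Disk -> C := fun z => Cplus (f z) (g z).
Definition fminus (f g : Disk -> C) : Disk -> C := fun z => Cminus (f z) (g z).
Definition fmult (f g : Disk -> C) : Disk -> C := fun z => Cmult (f z) (g z).
Definition fscal (a : C) (f : Disk -> C) : Disk -> C := fun z => Cmult a (f z).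

Definition power_expansion (f : Disk -> C) (a : nat -> C) : Prop :=
  forall z : Disk, @is_pseries C_AbsRing C_NormedModule a (disk_val z) (f z).

(* The coefficients of the power series of [f], which exist and are unique
   when [f] is holomorphic. *)
Definition taylor (f : Disk -> C) : nat -> C :=
  epsilon (inhabits (fun _ : nat => RtoC 0)) (power_expansion f).

(* [Rpower 0 s] is 1 in the library, whence the case [n = 0]. *)
Definition nat_rpow (n : nat) (s : R) : R :=
  match n with
  | O => 0
  | S _ => Rpower (INR n) s
  end.

(* The terms are nonnegative, so this limit is the sum of the series in
   [0, +oo]; it is finite when [f] is in F^p and [c > 0]. *)
Definition seminorm (p c : R) (f : Disk -> C) : Rbar :=
  Lim_seq (sum_n (fun n =>
    Cmod (taylor f n) * exp (- c * nat_rpow n (1 / (p + 1))))).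

(* The locally convex topology on F^p: finite intersections of seminorm balls
   centred at [f] form a neighbourhood base at [f]. Only the trace of [U] on
   F^p matters. *)
Definition Fp_open (p : R) (U : (Disk -> C) -> Prop) : Prop :=
  forall f, in_Fp p f -> U f ->
    exists (cs : list R) (delta : R),
      (forall c, In c cs -> 0 < c) /\ 0 < delta /\
      forall g, in_Fp p g ->
        (forall c, In c cs ->
           Rbar_lt (seminorm p c (fminus g f)) (Finite delta)) ->
        U g.

(* A map on F^p is represented by a map on all functions on the disk, of which
   only the values on F^p are ever used. *)
Definition Fp_continuous (p : R) (gamma : (Disk -> C) -> C) : Prop :=
  forall V : C -> Prop, open V -> Fp_open p (fun f => V (gamma f)).

Definition Fp_linear (p : R) (gamma : (Disk -> C) -> C) : Prop :=
  (forall f g, in_Fp p f -> in_Fp p g ->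
     gamma (fplus f g) = Cplus (gamma f) (gamma g)) /\
  (forall (a : C) f, in_Fp p f -> gamma (fscal a f) = Cmult a (gamma f)).

Definition Fp_multiplicative (p : R) (gamma : (Disk -> C) -> C) : Prop :=
  forall f g, in_Fp p f -> in_Fp p g ->
    gamma (fmult f g) = Cmult (gamma f) (gamma g).

(* Main.v *)
Require Import Defs.
From Stdlib Require Import Reals Lra Lia List Classical ClassicalEpsilon FunctionalExtensionality.
From Coquelicot Require Import Coquelicot.
Open Scope R_scope.

(* With [lambda := gamma(z)], the function [z - lambda] is in the kernel of [gamma], hence is not
   invertible in F^p. As [1/(z - lambda)] would be in F^p for [|lambda| >= 1], [lambda] is in the
   disk. For [f] in F^p, [f - f(lambda) = (z - lambda) g] with [g] again in F^p, so
   [gamma f = f(lambda)]. Evaluation at [lambda] is continuous because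
   [|lambda|^n <= exp(-c n^(1/(p+1)))] for a suitable [c > 0].

   That [g] is holomorphic at [lambda], and that Taylor coefficients exist, rests on Cauchy's
   formula for merely differentiable functions. It is obtained by running Goursat's bisection on
   the form [f(z) dz/(z - a)] in the coordinates [z = a + e^u (R e^(it) - a)], [u <= 0]: the
   singularity [a] lies at [u = -oo], and the boundary of [[u0, 0] x [0, 2 PI]] compares the
   integral over the circle of radius [R] with that over arbitrarily small curves around [a]. *)

(** [holomorphic] asks for a complex derivative at each point and says nothing about its continuity,
    so Green's theorem and differentiation under the integral sign are not at hand; bisection only
    needs the affine approximation of [f] at a single point. In the coordinates [(u, t)] the form is
    [f (du + kern t dt)] with bounded coefficients on an ordinary rectangle, and its sides t = 0 and
    t = 2 PI cancel by periodicity. Cauchy's formula first appears with the unknown factor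
    [CInt kern 0 (2 * PI)]; the value 2 PI i comes out afterwards, from the power series expansion
    applied to the constant function 1.

    In the second half the difficulty is to stay inside F^p after a division. Every membership goes
    through one of two estimates: |h| <= A + B |f| with f in F^p, or |h| <= 1 / (1 - |z|). In both
    the extra contribution to log^+ M is at most logarithmic in 1 / (1 - r), and the weight (1 -
    r)^(1/p) kills it. For continuity, the inequality 1/(p+1) <= 1 is what places a geometric
    sequence below the weights of a seminorm. *)

Notation ccont := (@continuous R_UniformSpace C_UniformSpace) (only parsing).
Notation is_CInt := (@is_RInt C_R_NormedModule) (only parsing).
Notation CInt := (@RInt C_R_CompleteNormedModule) (only parsing).
Notation is_Cpseries := (@is_pseries C_AbsRing C_NormedModule) (only parsing).
Notation is_C_derive := (@is_derive C_AbsRing C_NormedModule) (only parsing).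
Notation ex_C_derive := (@ex_derive C_AbsRing C_NormedModule) (only parsing).

(** * Curves and integrals with complex values *)

Lemma ccont_pair (x y : R -> R) (t : R) :
  continuous x t -> continuous y t -> ccont (fun s => (x s, y s)) t.
Proof.
  intros hx hy.
  apply (continuous_comp_2 x y (fun u v : R => (u, v) : C_UniformSpace)); auto.
  apply continuous_ext with (fun z : R * R => z).
  - now intros [u v].
  - apply continuous_id.
Qed.

Lemma ccont_Re (f : R -> C) (t : R) : ccont f t -> continuous (fun s => fst (f s)) t.
Proof.
  intros h. apply (continuous_comp f (fun z : C => fst z)); auto.
  apply (@continuous_fst R_UniformSpace R_UniformSpace).
Qed.

Lemma ccont_Im (f : R -> C) (t : R) : ccont f t -> continuous (fun s => snd (f s)) t.
Proof.
  intros h. apply (continuous_comp f (fun z : C => snd z)); auto.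
  apply (@continuous_snd R_UniformSpace R_UniformSpace).
Qed.

Lemma ccont_mult (f g : R -> C) (t : R) :
  ccont f t -> ccont g t -> ccont (fun s => Cmult (f s) (g s)) t.
Proof.
  intros hf hg.
  assert (h1 := ccont_Re f t hf). assert (h2 := ccont_Im f t hf).
  assert (h3 := ccont_Re g t hg). assert (h4 := ccont_Im g t hg).
  apply ccont_pair.
  - apply (@continuous_minus R_UniformSpace R_AbsRing R_NormedModule);
      apply (@continuous_mult R_UniformSpace R_AbsRing); assumption.
  - apply (@continuous_plus R_UniformSpace R_AbsRing R_NormedModule);
      apply (@continuous_mult R_UniformSpace R_AbsRing); assumption.
Qed.

Lemma ccont_minus (f g : R -> C) (t : R) :
  ccont f t -> ccont g t -> ccont (fun s => Cminus (f s) (g s)) t.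
Proof. exact (@continuous_minus R_UniformSpace R_AbsRing C_R_NormedModule f g t). Qed.

Lemma ccont_plus (f g : R -> C) (t : R) :
  ccont f t -> ccont g t -> ccont (fun s => Cplus (f s) (g s)) t.
Proof. exact (@continuous_plus R_UniformSpace R_AbsRing C_R_NormedModule f g t). Qed.

Lemma ccont_const (c : C) (t : R) : ccont (fun _ => c) t.
Proof. apply continuous_const. Qed.

Lemma ccont_inv (f : R -> C) (t : R) :
  ccont f t -> f t <> 0%C -> ccont (fun s => Cinv (f s)) t.
Proof.
  intros hf h0.
  assert (h1 := ccont_Re f t hf). assert (h2 := ccont_Im f t hf).
  assert (hn : fst (f t) ^ 2 + snd (f t) ^ 2 <> 0).
  { intros e. apply h0. apply injective_projections; simpl; nra. }
  assert (hd : continuous (fun s => / (fst (f s) ^ 2 + snd (f s) ^ 2)) t).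
  { apply (continuous_comp (fun s => fst (f s) ^ 2 + snd (f s) ^ 2) Rinv).
    - apply (@continuous_plus R_UniformSpace R_AbsRing R_NormedModule);
        simpl; apply (@continuous_mult R_UniformSpace R_AbsRing); auto;
        apply (@continuous_mult R_UniformSpace R_AbsRing); auto;
        apply continuous_const.
    - apply continuity_pt_filterlim. apply continuity_pt_inv; auto.
      apply continuity_pt_id. }
  apply ccont_pair; apply (@continuous_mult R_UniformSpace R_AbsRing); auto.
  apply (@continuous_opp R_UniformSpace R_AbsRing R_NormedModule); auto.
Qed.

Lemma ccont_pow (g : R -> C) (n : nat) (t : R) : ccont g t -> ccont (fun s => g s ^ n)%C t.
Proof.
  intros hg. induction n as [|n IH]; simpl; [apply ccont_const|]. now apply ccont_mult.
Qed.

Lemma ccont_ex_CInt (f : R -> C) (a b : R) : a <= b ->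
  (forall t, a <= t <= b -> ccont f t) -> is_CInt f a b (CInt f a b).
Proof.
  intros hab h. apply (@RInt_correct C_R_CompleteNormedModule).
  apply (@ex_RInt_continuous C_R_CompleteNormedModule).
  rewrite Rmin_left, Rmax_right; auto.
Qed.

Lemma is_CInt_minus (f g : R -> C) (a b : R) (k l : C) :
  is_CInt f a b k -> is_CInt g a b l ->
  is_CInt (fun t => Cminus (f t) (g t)) a b (Cminus k l).
Proof. exact (@is_RInt_minus C_R_NormedModule f g a b k l). Qed.

(** The integral is taken in C as a real normed module, whose linearity covers real scalars; a
    complex scalar is handled through the two coordinates. *)
Lemma is_CInt_mult_l (c : C) (f : R -> C) (a b : R) (l : C) :
  is_CInt f a b l -> is_CInt (fun t => Cmult c (f t)) a b (Cmult c l).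
Proof.
  intros h.
  assert (h1 := is_RInt_fct_extend_fst _ _ _ _ h).
  assert (h2 := is_RInt_fct_extend_snd _ _ _ _ h).
  apply (@is_RInt_fct_extend_pair R_NormedModule R_NormedModule); simpl.
  - apply (@is_RInt_minus R_NormedModule);
      apply (@is_RInt_scal R_NormedModule); assumption.
  - apply (@is_RInt_plus R_NormedModule);
      apply (@is_RInt_scal R_NormedModule); assumption.
Qed.

Lemma is_CInt_ext (f g : R -> C) (a b : R) (l : C) : a <= b ->
  (forall t, a <= t <= b -> f t = g t) -> is_CInt f a b l -> is_CInt g a b l.
Proof.
  intros hab h. apply (@is_RInt_ext C_R_NormedModule).
  rewrite Rmin_left, Rmax_right; auto. intros x hx; apply h; lra.
Qed.

Lemma is_CInt_unique (f : R -> C) (a b : R) (k l : C) :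
  is_CInt f a b k -> is_CInt f a b l -> k = l.
Proof.
  intros h1 h2. rewrite <- (@is_RInt_unique C_R_CompleteNormedModule _ _ _ _ h1).
  exact (@is_RInt_unique C_R_CompleteNormedModule _ _ _ _ h2).
Qed.

Lemma Cmod_CInt_le (f : R -> C) (g : R -> R) (a b : R) (l : C) (m : R) : a <= b ->
  (forall t, a <= t <= b -> Cmod (f t) <= g t) ->
  is_CInt f a b l -> is_RInt g a b m -> Cmod l <= m.
Proof.
  intros hab h hf hg. rewrite Cmod_norm.
  apply (@norm_RInt_le C_R_NormedModule f g a b); auto.
  intros x hx. specialize (h x hx). rewrite Cmod_norm in h. exact h.
Qed.

Lemma Cmod_CInt_le_const (f : R -> C) (M a b : R) (l : C) : a <= b ->
  (forall t, a <= t <= b -> Cmod (f t) <= M) ->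
  is_CInt f a b l -> Cmod l <= (b - a) * M.
Proof.
  intros hab h hf. apply (Cmod_CInt_le f (fun _ => M) a b); auto.
  apply (@is_RInt_const R_NormedModule).
Qed.

Lemma is_CInt_derive (x y dx dy : R -> R) (a b : R) :
  (forall t, is_derive x t (dx t)) -> (forall t, is_derive y t (dy t)) ->
  (forall t, continuous dx t) -> (forall t, continuous dy t) ->
  is_CInt (fun t => (dx t, dy t)) a b (x b - x a, y b - y a).
Proof.
  intros hx hy cx cy.
  apply (@is_RInt_fct_extend_pair R_NormedModule R_NormedModule); simpl.
  - apply (@is_RInt_derive R_CompleteNormedModule x dx); auto.
  - apply (@is_RInt_derive R_CompleteNormedModule y dy); auto.
Qed.

Lemma is_CInt_const (c : C) (a b : R) : is_CInt (fun _ => c) a b (Cmult (RtoC (b - a)) c).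
Proof.
  assert (h := @is_RInt_const C_R_NormedModule a b c).
  replace (Cmult (RtoC (b - a)) c) with (@scal R_AbsRing C_R_NormedModule (b - a) c); auto.
  destruct c as [x y]. unfold scal, Cmult; simpl. unfold prod_scal; simpl.
  unfold scal; simpl; unfold mult; simpl. f_equal; ring.
Qed.

Lemma is_C_derive_iff (f : C -> C) (z l : C) :
  is_C_derive f z l <->
  (forall eps, 0 < eps -> exists delta, 0 < delta /\ forall w, Cmod (w - z) < delta ->
     Cmod (f w - f z - (w - z) * l) <= eps * Cmod (w - z)).
Proof.
  split.
  - intros [_ h] eps heps.
    specialize (h z (fun P H => H) (mkposreal eps heps)).
    destruct h as [d hd]. exists d. split; [apply cond_pos|].
    intros w hw. exact (hd w hw).
  - intros h. split.
    + apply (@is_linear_scal_l C_AbsRing C_NormedModule l).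
    + intros x hx.
      (* The differentiability predicate quantifies over every limit point of the filter; for the
         neighbourhoods of [z] this is [z] alone. *)
      apply (@is_filter_lim_locally_unique C_AbsRing (AbsRing_NormedModule C_AbsRing)) in hx.
      subst x. intros eps.
      destruct (h eps (cond_pos eps)) as [d [hd hw]].
      exists (mkposreal d hd). intros y hy. exact (hw y hy).
Qed.

(** Differentiation uses the neighbourhoods given by the absolute value, integration those of the
    product R x R; [locally_C] says that they agree. *)
Lemma is_C_derive_continuous (f : C -> C) (z l : C) :
  is_C_derive f z l ->
  @continuous C_UniformSpace C_UniformSpace f z.
Proof.
  intros h.
  assert (h' : ex_C_derive f z) by (exists l; exact h).
  apply ex_derive_continuous in h'.
  intros P hP. specialize (h' P hP).
  unfold filtermap in *. now apply locally_C.
Qed.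

(** * Bisection of rectangles *)

Lemma nested_intervals (u v : nat -> R) :
  (forall n, u n <= u (S n)) -> (forall n, v (S n) <= v n) -> (forall n, u n <= v n) ->
  exists x, forall n, u n <= x <= v n.
Proof.
  intros hu hv huv.
  assert (mu : forall n k, u n <= u (n + k)%nat).
  { intros n k; induction k as [|k IH].
    - rewrite Nat.add_0_r; lra.
    - rewrite Nat.add_succ_r. specialize (hu (n + k)%nat); lra. }
  assert (mv : forall n k, v (n + k)%nat <= v n).
  { intros n k; induction k as [|k IH].
    - rewrite Nat.add_0_r; lra.
    - rewrite Nat.add_succ_r. specialize (hv (n + k)%nat); lra. }
  assert (cross : forall n m, u n <= v m).
  { intros n m. specialize (mu n m). specialize (mv m n). specialize (huv (n + m)%nat).
    rewrite (Nat.add_comm m n) in mv. lra. }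
  destruct (completeness (fun y => exists n, y = u n)) as [x [hx1 hx2]].
  - exists (v 0%nat). intros y [n ->]. apply cross.
  - exists (u 0%nat), 0%nat. reflexivity.
  - exists x. intros n. split.
    + apply hx1. now exists n.
    + apply hx2. intros y [m ->]. apply cross.
Qed.

Definition rect : Type := ((R * R) * (R * R))%type.

Definition quarter (i j : bool) (q : rect) : rect :=
  let '((u1, u2), (t1, t2)) := q in
  let m := (u1 + u2) / 2 in
  let n := (t1 + t2) / 2 in
  ((if i then m else u1, if i then u2 else m), (if j then n else t1, if j then t2 else n)).

Section Bisection.

Variable E : R -> R -> R -> R -> C.
Let Er (q : rect) : C := E (fst (fst q)) (snd (fst q)) (fst (snd q)) (snd (snd q)).

(** The last quarter is taken without a test: when [E] is additive and the three others fall below a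
    quarter of |E|, the triangle inequality forces this one to reach it. *)
Definition big_quarter (q : rect) : rect :=
  let good i j := Rle_dec (Cmod (Er q) / 4) (Cmod (Er (quarter i j q))) in
  if good true true then quarter true true q
  else if good true false then quarter true false q
  else if good false true then quarter false true q
  else quarter false false q.

Fixpoint quarters (q : rect) (k : nat) : rect :=
  match k with
  | O => q
  | S k => big_quarter (quarters q k)
  end.

Lemma big_quarter_cases (q : rect) : exists i j, big_quarter q = quarter i j q.
Proof. unfold big_quarter; repeat destruct Rle_dec; eauto. Qed.

(** Goursat's argument detached from integrals. Repeated choice of a big quarter gives nested
    rectangles with |E| at least |E(a,b,c,d)| / 4^k and sides of order 2^(-k). They shrink to a
    point, where the local hypothesis bounds |E| by an arbitrarily small multiple of 4^(-k). *)
Lemma additive_rectangle_function_zero (a b c d : R) :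
  a <= b -> c <= d ->
  (forall u1 m u2 t1 n t2, a <= u1 -> u1 <= m -> m <= u2 -> u2 <= b ->
     c <= t1 -> t1 <= n -> n <= t2 -> t2 <= d ->
     E u1 u2 t1 t2 = (E u1 m t1 n + E u1 m n t2 + E m u2 t1 n + E m u2 n t2)%C) ->
  (forall x y, a <= x <= b -> c <= y <= d -> forall eps, 0 < eps ->
     exists delta, 0 < delta /\
     forall u1 u2 t1 t2, a <= u1 -> u1 <= x <= u2 -> u2 <= b ->
       c <= t1 -> t1 <= y <= t2 -> t2 <= d -> u2 - u1 < delta -> t2 - t1 < delta ->
       Cmod (E u1 u2 t1 t2) <= eps * (u2 - u1 + (t2 - t1)) ^ 2) ->
  E a b c d = 0%C.
Proof.
  intros hab hcd add loc.
  apply Cmod_eq_0. destruct (Req_dec (Cmod (E a b c d)) 0) as [|hne]; auto. exfalso.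
  assert (hpos : 0 < Cmod (E a b c d)) by (generalize (Cmod_ge_0 (E a b c d)); lra).
  set (Q := quarters ((a, b), (c, d))).
  set (U1 := fun k => fst (fst (Q k))). set (U2 := fun k => snd (fst (Q k))).
  set (T1 := fun k => fst (snd (Q k))). set (T2 := fun k => snd (snd (Q k))).
  assert (step : forall k,
    U1 k <= U2 k -> T1 k <= T2 k ->
    U1 k <= U1 (S k) /\ U2 (S k) <= U2 k /\ T1 k <= T1 (S k) /\ T2 (S k) <= T2 k /\
    U2 (S k) - U1 (S k) = (U2 k - U1 k) / 2 /\ T2 (S k) - T1 (S k) = (T2 k - T1 k) / 2).
  { intros k. unfold U1, U2, T1, T2. change (Q (S k)) with (big_quarter (Q k)).
    destruct (big_quarter_cases (Q k)) as [i [j ->]].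
    destruct (Q k) as [[u1 u2] [t1 t2]]. destruct i, j; simpl; lra. }
  assert (inv : forall k, a <= U1 k /\ U1 k <= U2 k /\ U2 k <= b /\
    c <= T1 k /\ T1 k <= T2 k /\ T2 k <= d /\
    U2 k - U1 k = (b - a) / 2 ^ k /\ T2 k - T1 k = (d - c) / 2 ^ k).
  { induction k as [|k IH].
    - unfold U1, U2, T1, T2; simpl. repeat split; try lra; field.
    - destruct IH as (h1 & h2 & h3 & h4 & h5 & h6 & h7 & h8).
      destruct (step k h2 h5) as (s1 & s2 & s3 & s4 & s5 & s6).
      assert (0 < 2 ^ k) by (apply pow_lt; lra).
      repeat split; try lra; simpl.
      + rewrite s5, h7. field. lra.
      + rewrite s6, h8. field. lra. }
  assert (low : forall k, Cmod (E a b c d) / 4 ^ k <= Cmod (Er (Q k))).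
  { induction k as [|k IH].
    - unfold Er; simpl. lra.
    - assert (hk : Cmod (Er (Q k)) / 4 <= Cmod (Er (Q (S k)))).
      { destruct (inv k) as (h1 & h2 & h3 & h4 & h5 & h6 & _).
        change (Q (S k)) with (big_quarter (Q k)).
        unfold U1, U2, T1, T2 in *. clear IH.
        unfold big_quarter. repeat destruct Rle_dec; auto.
        destruct (Q k) as [[u1 u2] [t1 t2]]. unfold Er in *; simpl in *.
        repeat match goal with H : ~ (_ <= _) |- _ => apply Rnot_le_lt in H end.
        assert (hE := add u1 ((u1 + u2) / 2) u2 t1 ((t1 + t2) / 2) t2
          ltac:(lra) ltac:(lra) ltac:(lra) ltac:(lra) ltac:(lra) ltac:(lra) ltac:(lra) ltac:(lra)).
        match type of hE with _ = (?x + ?y + ?z + ?w)%C =>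
          assert (hT := Cmod_triangle (x + y + z) w);
          assert (hT2 := Cmod_triangle (x + y) z);
          assert (hT3 := Cmod_triangle x y)
        end.
        rewrite <- hE in hT.
        lra. }
      assert (0 < 4 ^ k) by (apply pow_lt; lra).
      replace (Cmod (E a b c d) / 4 ^ S k) with (Cmod (E a b c d) / 4 ^ k / 4)
        by (simpl; field; lra).
      lra. }
  destruct (nested_intervals U1 U2) as [x hx];
    [intros k; destruct (inv k); apply step; tauto .. | intros k; apply (inv k) | ].
  destruct (nested_intervals T1 T2) as [y hy];
    [intros k; destruct (inv k); apply step; tauto .. | intros k; apply (inv k) | ].
  set (s := b - a + (d - c)).
  set (eta := Cmod (E a b c d)) in *.
  assert (hs : 0 <= s) by (unfold s; lra).
  (* With this tolerance the local bound on the k-th rectangle is at most [eta] / 4^k times s^2 / (2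
     (s^2 + 1)), a factor below 1; the added 1 keeps the denominator nonzero when [s] is 0. *)
  destruct (loc x y) with (eps := eta / (2 * (s ^ 2 + 1))) as [delta [hdelta hloc]].
  - destruct (hx 0%nat). unfold U1, U2 in *; simpl in *; lra.
  - destruct (hy 0%nat). unfold T1, T2 in *; simpl in *; lra.
  - apply Rdiv_lt_0_compat; nra.
  - destruct (pow_lt_1_zero (/ 2)) with (y := delta / (s + 1)) as [N hN].
    + rewrite Rabs_pos_eq; lra.
    + apply Rdiv_lt_0_compat; lra.
    + specialize (hN N (le_n N)).
      rewrite Rabs_pos_eq in hN by (apply pow_le; lra).
      destruct (inv N) as (h1 & h2 & h3 & h4 & h5 & h6 & h7 & h8).
      assert (p2 : 0 < (/ 2) ^ N) by (apply pow_lt; lra).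
      assert (e2 : / 2 ^ N = (/ 2) ^ N) by now rewrite pow_inv.
      unfold Rdiv in h7, h8. rewrite e2 in h7, h8.
      assert (hq : (/ 2) ^ N * (s + 1) < delta).
      { apply Rmult_lt_compat_r with (r := s + 1) in hN; [|lra].
        unfold Rdiv in hN. rewrite Rmult_assoc, Rinv_l in hN; lra. }
      assert (hE : Cmod (Er (Q N)) <= eta / (2 * (s ^ 2 + 1)) * (s * (/ 2) ^ N) ^ 2).
      { eapply Rle_trans.
        - apply (hloc (U1 N) (U2 N) (T1 N) (T2 N)); auto; rewrite ?h7, ?h8; unfold s in *; nra.
        - apply Req_le. rewrite h7, h8. unfold s. ring. }
      specialize (low N).
      assert (e4 : / 4 ^ N = ((/ 2) ^ N) ^ 2).
      { rewrite <- pow_inv. replace (/ 4) with (/ 2 * / 2) by field.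
        rewrite Rpow_mult_distr. ring. }
      unfold Rdiv in low at 1. rewrite e4 in low.
      assert (hk : s ^ 2 / (2 * (s ^ 2 + 1)) < 1).
      { apply Rmult_lt_reg_r with (2 * (s ^ 2 + 1)); [nra|].
        unfold Rdiv. rewrite Rmult_assoc, Rinv_l; nra. }
      assert (eta * ((/ 2) ^ N) ^ 2 <= s ^ 2 / (2 * (s ^ 2 + 1)) * (eta * ((/ 2) ^ N) ^ 2)).
      { eapply Rle_trans; [exact low|]. eapply Rle_trans; [exact hE|].
        apply Req_le. field. nra. }
      assert (0 < eta * ((/ 2) ^ N) ^ 2) by (apply Rmult_lt_0_compat; [|apply pow_lt]; auto).
      nra.
Qed.

End Bisection.

(** * Cauchy's formula *)

Definition cis (t : R) : C := (cos t, sin t).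

Lemma Cmod_cis (t : R) : Cmod (cis t) = 1.
Proof.
  unfold Cmod, cis; simpl.
  replace (cos t * (cos t * 1) + sin t * (sin t * 1)) with 1; [apply sqrt_1|].
  generalize (sin2_cos2 t); unfold Rsqr; lra.
Qed.

Lemma ccont_cis (t : R) : ccont cis t.
Proof. apply ccont_pair; [apply continuous_cos | apply continuous_sin]. Qed.

Lemma exp_le_1 (u : R) : u <= 0 -> exp u <= 1.
Proof.
  intros h. rewrite <- exp_0. destruct h as [h | ->]; [|lra]. left; apply exp_increasing; lra.
Qed.

Lemma Rabs_exp_minus_le (u x : R) : u <= 0 -> x <= 0 -> Rabs (exp u - exp x) <= Rabs (u - x).
Proof.
  assert (h : forall v y, v <= y -> y <= 0 -> Rabs (exp v - exp y) <= Rabs (v - y)).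
  { intros v y hvy hy.
    assert (e : exp v = exp y * exp (v - y)) by (rewrite <- exp_plus; f_equal; ring).
    assert (h1 := exp_ineq1_le (v - y)).
    assert (h2 : 0 < exp y) by apply exp_pos.
    assert (h3 := exp_le_1 y hy).
    assert (h4 : exp v <= exp y).
    { destruct hvy as [hvy | ->]; [|lra]. left; apply exp_increasing; lra. }
    rewrite !Rabs_left1 by lra. nra. }
  intros hu hx. destruct (Rle_dec u x) as [hux | hux].
  - now apply h.
  - rewrite (Rabs_minus_sym (exp u)), (Rabs_minus_sym u). apply h; lra.
Qed.

Lemma Rabs_minus_le_of_derive (f df : R -> R) (x y : R) :
  (forall t, is_derive f t (df t)) -> (forall t, Rabs (df t) <= 1) ->
  Rabs (f y - f x) <= Rabs (y - x).
Proof.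
  intros h hb.
  destruct (MVT_gen f x y df) as [c [_ ->]].
  - auto.
  - intros t _. apply continuity_pt_filterlim.
    apply (@ex_derive_continuous R_AbsRing R_NormedModule). now exists (df t).
  - rewrite Rabs_mult. specialize (hb c). generalize (Rabs_pos (y - x)). nra.
Qed.

Lemma Cmod_le_Rabs (z : C) : Cmod z <= Rabs (fst z) + Rabs (snd z).
Proof.
  destruct z as [x y]. simpl.
  replace ((x, y) : C) with (RtoC x + Ci * RtoC y)%C
    by (unfold RtoC, Ci, Cplus, Cmult; simpl; f_equal; ring).
  eapply Rle_trans; [apply Cmod_triangle|].
  rewrite Cmod_mult, Cmod_Ci, !Cmod_R. lra.
Qed.

Lemma Cmod_cis_minus_le (t y : R) : Cmod (cis t - cis y) <= 2 * Rabs (t - y).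
Proof.
  eapply Rle_trans; [apply Cmod_le_Rabs|]. simpl.
  assert (h1 : Rabs (cos t - cos y) <= Rabs (t - y)).
  { apply Rabs_minus_le_of_derive with (fun t => - sin t).
    - intros s. auto_derive; auto. ring.
    - intros s. rewrite Rabs_Ropp. apply Rabs_le. generalize (SIN_bound s); lra. }
  assert (h2 : Rabs (sin t - sin y) <= Rabs (t - y)).
  { apply Rabs_minus_le_of_derive with cos.
    - intros s. auto_derive; auto. ring.
    - intros s. apply Rabs_le. generalize (COS_bound s); lra. }
  unfold Rminus in *. lra.
Qed.

Lemma is_CInt_exp (a b : R) : is_CInt (fun u => RtoC (exp u)) a b (RtoC (exp b - exp a)).
Proof.
  replace (RtoC (exp b - exp a)) with ((exp b - exp a, 0 - 0) : C)
    by (unfold RtoC; f_equal; ring).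
  apply (is_CInt_derive exp (fun _ => 0) exp (fun _ => 0)).
  - intros t. apply is_derive_exp.
  - intros t. apply (@is_derive_const R_AbsRing R_NormedModule).
  - intros t. apply continuous_exp.
  - intros t. apply continuous_const.
Qed.

Lemma is_CInt_cis (a b : R) : is_CInt (fun t => Ci * cis t)%C a b (cis b - cis a)%C.
Proof.
  apply (@is_RInt_ext C_R_NormedModule) with (fun t => (- sin t, cos t) : C).
  { intros t _. unfold Ci, cis, Cmult; simpl. f_equal; ring. }
  apply (is_CInt_derive cos sin).
  - intros t. auto_derive; auto. ring.
  - intros t. auto_derive; auto. ring.
  - intros t. apply (@continuous_opp R_UniformSpace R_AbsRing R_NormedModule).
    apply continuous_sin.
  - intros t. apply continuous_cos.
Qed.

Section Cauchy.

Variables (f : C -> C) (R0 : R) (a : C).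
Hypothesis hR : 0 < R0.
Hypothesis ha : Cmod a < R0.

Definition arm (t : R) : C := (RtoC R0 * cis t - a)%C.
(** The logarithmic derivative of [arm]. It is independent of [u] and bounded by R0 / (R0 - |a|), so
    in these coordinates the pole at [a] leaves no unbounded coefficient. *)
Definition kern (t : R) : C := (RtoC R0 * (Ci * cis t) / arm t)%C.
Definition pull (u t : R) : C := (RtoC (exp u) * arm t)%C.

Lemma Cmod_circle (t : R) : Cmod (RtoC R0 * cis t) = R0.
Proof. rewrite Cmod_mult, Cmod_cis, Cmod_R, Rabs_pos_eq; lra. Qed.

Lemma Cmod_arm_ge (t : R) : R0 - Cmod a <= Cmod (arm t).
Proof.
  assert (h := Cmod_triangle (arm t) a).
  replace (arm t + a)%C with (RtoC R0 * cis t)%C in h by (unfold arm; ring).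
  rewrite Cmod_circle in h. lra.
Qed.

Lemma Cmod_arm_le (t : R) : Cmod (arm t) <= 2 * R0.
Proof.
  unfold arm, Cminus. eapply Rle_trans; [apply Cmod_triangle|].
  rewrite Cmod_circle, Cmod_opp. lra.
Qed.

Lemma arm_neq_0 (t : R) : arm t <> 0%C.
Proof. apply Cmod_gt_0. generalize (Cmod_arm_ge t). lra. Qed.

Lemma Cmod_kern_le (t : R) : Cmod (kern t) <= R0 / (R0 - Cmod a).
Proof.
  unfold kern. rewrite Cmod_div by apply arm_neq_0.
  rewrite !Cmod_mult, Cmod_Ci, Cmod_cis, Cmod_R, Rabs_pos_eq by lra.
  replace (R0 * (1 * 1)) with R0 by ring.
  apply Rmult_le_compat_l; [lra|]. apply Rinv_le_contravar; [lra|]. apply Cmod_arm_ge.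
Qed.

Lemma ccont_arm (t : R) : ccont arm t.
Proof.
  apply ccont_minus; [|apply ccont_const].
  apply ccont_mult; [apply ccont_const | apply ccont_cis].
Qed.

Lemma ccont_kern (t : R) : ccont kern t.
Proof.
  apply ccont_mult.
  - apply ccont_mult; [apply ccont_const|].
    apply ccont_mult; [apply ccont_const | apply ccont_cis].
  - apply ccont_inv; [apply ccont_arm | apply arm_neq_0].
Qed.

(** The point is a convex combination of [a] and a point of the circle, with weights 1 - e^u and
    e^u. Hence the whole deformation stays where [f] is differentiable. *)
Lemma Cmod_pull_le (u t : R) : u <= 0 -> Cmod (a + pull u t) <= R0.
Proof.
  intros hu.
  assert (h0 := exp_pos u). assert (h1 := exp_le_1 u hu).
  replace (a + pull u t)%C with (RtoC (1 - exp u) * a + RtoC (exp u) * (RtoC R0 * cis t))%C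
    by (unfold pull, arm; rewrite RtoC_minus; ring).
  eapply Rle_trans; [apply Cmod_triangle|].
  rewrite (Cmod_mult _ a), (Cmod_mult (RtoC (exp u))), Cmod_circle, !Cmod_R, !Rabs_pos_eq by lra.
  nra.
Qed.

Lemma Cmod_pull_minus_le (u t x y : R) : u <= 0 -> x <= 0 ->
  Cmod (pull u t - pull x y) <= 2 * R0 * (Rabs (u - x) + Rabs (t - y)).
Proof.
  intros hu hx.
  replace (pull u t - pull x y)%C
    with (RtoC (exp u - exp x) * arm t + RtoC (exp x) * (RtoC R0 * (cis t - cis y)))%C
    by (unfold pull, arm; rewrite RtoC_minus; ring).
  eapply Rle_trans; [apply Cmod_triangle|].
  rewrite (Cmod_mult _ (arm t)), (Cmod_mult (RtoC (exp x))), (Cmod_mult (RtoC R0)), !Cmod_R.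
  assert (h1 := Rabs_exp_minus_le u x hu hx).
  assert (h2 := Cmod_cis_minus_le t y).
  assert (h3 := Cmod_arm_le t). assert (h4 := exp_le_1 x hx). assert (h5 := exp_pos x).
  rewrite (Rabs_pos_eq (exp x)), (Rabs_pos_eq R0) by lra.
  assert (h6 := Cmod_ge_0 (cis t - cis y)). assert (h7 := Cmod_ge_0 (arm t)).
  assert (h8 := Rabs_pos (exp u - exp x)).
  assert (Rabs (exp u - exp x) * Cmod (arm t) <= Rabs (u - x) * (2 * R0))
    by (apply Rmult_le_compat; auto).
  assert (exp x * (R0 * Cmod (cis t - cis y)) <= 1 * (R0 * (2 * Rabs (t - y)))).
  { apply Rmult_le_compat; try lra.
    - apply Rmult_le_pos; lra.
    - apply Rmult_le_compat_l; lra. }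
  lra.
Qed.

Hypothesis hf : forall z, Cmod z <= R0 -> ex_C_derive f z.

Definition pull_fun (u t : R) : C := f (a + pull u t)%C.

Lemma ccont_pull_u (u t : R) : ccont (fun u => pull u t) u.
Proof.
  apply ccont_mult; [|apply ccont_const].
  apply ccont_pair; [apply continuous_exp | apply continuous_const].
Qed.

Lemma ccont_pull_t (u t : R) : ccont (fun t => pull u t) t.
Proof. apply ccont_mult; [apply ccont_const | apply ccont_arm]. Qed.

Lemma ccont_pull_fun_u (u t : R) : u <= 0 -> ccont (fun u => pull_fun u t) u.
Proof.
  intros hu. apply (continuous_comp (fun u => a + pull u t)%C f).
  - apply ccont_plus; [apply ccont_const | apply ccont_pull_u].
  - destruct (hf _ (Cmod_pull_le u t hu)) as [l hl].
    exact (is_C_derive_continuous _ _ _ hl).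
Qed.

Lemma ccont_pull_fun_t (u t : R) : u <= 0 -> ccont (fun t => pull_fun u t) t.
Proof.
  intros hu. apply (continuous_comp (fun t => a + pull u t)%C f).
  - apply ccont_plus; [apply ccont_const | apply ccont_pull_t].
  - destruct (hf _ (Cmod_pull_le u t hu)) as [l hl].
    exact (is_C_derive_continuous _ _ _ hl).
Qed.

Definition radial_integral (u1 u2 t : R) : C := CInt (fun u => pull_fun u t) u1 u2.
Definition angular_integral (u t1 t2 : R) : C := CInt (fun t => pull_fun u t * kern t)%C t1 t2.

Lemma is_CInt_radial (u1 u2 t : R) : u1 <= u2 -> u2 <= 0 ->
  is_CInt (fun u => pull_fun u t) u1 u2 (radial_integral u1 u2 t).
Proof. intros h1 h2. apply ccont_ex_CInt; auto. intros u hu. apply ccont_pull_fun_u; lra. Qed.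

Lemma is_CInt_angular (u t1 t2 : R) : u <= 0 -> t1 <= t2 ->
  is_CInt (fun t => pull_fun u t * kern t)%C t1 t2 (angular_integral u t1 t2).
Proof.
  intros h1 h2. apply ccont_ex_CInt; auto. intros t ht.
  apply ccont_mult; [now apply ccont_pull_fun_t | apply ccont_kern].
Qed.

Lemma radial_integral_Chasles (u1 m u2 t : R) : u1 <= m -> m <= u2 -> u2 <= 0 ->
  radial_integral u1 u2 t = (radial_integral u1 m t + radial_integral m u2 t)%C.
Proof.
  intros h1 h2 h3. eapply is_CInt_unique; [apply is_CInt_radial; lra|].
  apply (@is_RInt_Chasles C_R_NormedModule) with m; apply is_CInt_radial; lra.
Qed.

Lemma angular_integral_Chasles (u t1 n t2 : R) : u <= 0 -> t1 <= n -> n <= t2 ->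
  angular_integral u t1 t2 = (angular_integral u t1 n + angular_integral u n t2)%C.
Proof.
  intros h1 h2 h3. eapply is_CInt_unique; [apply is_CInt_angular; lra|].
  apply (@is_RInt_Chasles C_R_NormedModule) with n; apply is_CInt_angular; lra.
Qed.

(* The integral of [f(z) dz / (z - a)] along the boundary of a curvilinear rectangle
   in the coordinates [z = a + pull u t], for which [dz / (z - a) = du + kern t dt]. *)
Definition boundary_integral (u1 u2 t1 t2 : R) : C :=
  (radial_integral u1 u2 t1 - radial_integral u1 u2 t2 +
   (angular_integral u2 t1 t2 - angular_integral u1 t1 t2))%C.

(** Subtract from [f] its affine approximation at [a + pull x y]. The constant part cancels between
    opposite sides, and the linear part gives [- l * D] on the radial sides and [+ l * D] on the
    angular ones. What remains is a remainder of size eps * s integrated over sides of total length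
    of order s. *)
Lemma boundary_integral_local (x y : R) : x <= 0 -> forall eps, 0 < eps ->
  exists delta, 0 < delta /\
  forall u1 u2 t1 t2, u1 <= x <= u2 -> u2 <= 0 -> t1 <= y <= t2 ->
    u2 - u1 < delta -> t2 - t1 < delta ->
    Cmod (boundary_integral u1 u2 t1 t2) <= eps * (u2 - u1 + (t2 - t1)) ^ 2.
Proof.
  intros hx eps heps.
  destruct (hf _ (Cmod_pull_le x y hx)) as [l hl].
  rewrite is_C_derive_iff in hl.
  set (M := 1 + R0 / (R0 - Cmod a)).
  assert (hq : 0 < R0 / (R0 - Cmod a)) by (apply Rdiv_lt_0_compat; lra).
  (* Here 2 R0 is a Lipschitz constant of [pull], another factor 2 pays for the two opposite sides,
     and [M] is the sum of the bounds 1 for [du] and R0 / (R0 - |a|) for [kern]. *)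
  destruct (hl (eps / (4 * R0 * M))) as [d [hd hw]].
  { apply Rdiv_lt_0_compat; auto. unfold M; nra. }
  (* Then s < d / (4 R0), so by the Lipschitz bound 2 R0 s the rectangle is mapped into the disk of
     radius d / 2 around the base point. *)
  exists (d / (8 * R0)). split; [apply Rdiv_lt_0_compat; lra|].
  intros u1 u2 t1 t2 hu hu2 ht du dt.
  set (s := u2 - u1 + (t2 - t1)).
  assert (hs : 0 <= s) by (unfold s; lra).
  set (G := fun u t => (pull_fun u t - pull_fun x y - (pull u t - pull x y) * l)%C).
  assert (hG : forall u t, u1 <= u <= u2 -> t1 <= t <= t2 -> Cmod (G u t) <= eps * s / (2 * M)).
  { intros u t hut htt.
    assert (hL := Cmod_pull_minus_le u t x y ltac:(lra) hx).
    assert (hs' : Rabs (u - x) + Rabs (t - y) <= s).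
    { assert (Rabs (u - x) <= u2 - u1) by (apply Rabs_le; lra).
      assert (Rabs (t - y) <= t2 - t1) by (apply Rabs_le; lra).
      unfold s; lra. }
    assert (hZ : Cmod (pull u t - pull x y) <= 2 * R0 * s)
      by (eapply Rle_trans; [exact hL|]; apply Rmult_le_compat_l; lra).
    assert (e : (a + pull u t - (a + pull x y))%C = (pull u t - pull x y)%C) by ring.
    specialize (hw (a + pull u t)%C). rewrite e in hw.
    assert (hdd : s < 2 * (d / (8 * R0))) by (unfold s; lra).
    assert (hlt : Cmod (pull u t - pull x y) < d).
    { eapply Rle_lt_trans; [exact hZ|].
      apply Rmult_lt_compat_l with (r := 2 * R0) in hdd; [|lra].
      replace (2 * R0 * (2 * (d / (8 * R0)))) with (d / 2) in hdd by (field; lra). lra. }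
    eapply Rle_trans; [apply (hw hlt)|].
    replace (eps * s / (2 * M)) with (eps / (4 * R0 * M) * (2 * R0 * s))
      by (field; unfold M; lra).
    apply Rmult_le_compat_l; auto.
    left. apply Rdiv_lt_0_compat; auto. unfold M; nra. }
  (* The mixed second difference of [pull] over the corners, up to sign. Both linear contributions
     are exact because e^u is its own antiderivative and [arm t * kern t] is the derivative of
     [arm]. *)
  set (D := (RtoC (exp u2 - exp u1) * (arm t1 - arm t2))%C).
  assert (IA : is_CInt (fun u => G u t1 - G u t2)%C u1 u2
                 (radial_integral u1 u2 t1 - radial_integral u1 u2 t2 - l * D)%C).
  { apply is_CInt_ext with
      (fun u => pull_fun u t1 - pull_fun u t2 - l * ((arm t1 - arm t2) * RtoC (exp u)))%C; [lra| |].
    - intros u _. unfold G, pull. ring.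
    - apply is_CInt_minus.
      + apply is_CInt_minus; apply is_CInt_radial; lra.
      + apply is_CInt_mult_l. unfold D. rewrite (Cmult_comm (RtoC _)).
        apply is_CInt_mult_l, is_CInt_exp. }
  assert (IB : is_CInt (fun t => (G u2 t - G u1 t) * kern t)%C t1 t2
                 (angular_integral u2 t1 t2 - angular_integral u1 t1 t2 + l * D)%C).
  { replace (angular_integral u2 t1 t2 - angular_integral u1 t1 t2 + l * D)%C
      with (angular_integral u2 t1 t2 - angular_integral u1 t1 t2 -
            l * (RtoC (exp u2 - exp u1) * (RtoC R0 * (cis t2 - cis t1))))%C
      by (unfold D, arm; ring).
    apply is_CInt_ext with
      (fun t => pull_fun u2 t * kern t - pull_fun u1 t * kern t -
         l * (RtoC (exp u2 - exp u1) * (RtoC R0 * (Ci * cis t))))%C; [lra| |].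
    - intros t _. rewrite RtoC_minus.
      replace (RtoC R0 * (Ci * cis t))%C with (arm t * kern t)%C
        by (unfold kern; field; apply arm_neq_0).
      unfold G, pull. ring.
    - apply is_CInt_minus.
      + apply is_CInt_minus; apply is_CInt_angular; lra.
      + repeat apply is_CInt_mult_l. apply is_CInt_cis. }
  assert (hM : 0 < M) by (unfold M; lra).
  apply Cmod_CInt_le_const with (M := eps * s / M) in IA; [|lra|].
  2: { intros u hu'. unfold Cminus. eapply Rle_trans; [apply Cmod_triangle|].
       rewrite Cmod_opp.
       assert (h1 := hG u t1 hu' ltac:(lra)). assert (h2 := hG u t2 hu' ltac:(lra)).
       replace (eps * s / M) with (eps * s / (2 * M) + eps * s / (2 * M)) by (field; lra).
       lra. }
  apply Cmod_CInt_le_const with (M := eps * s / M * (R0 / (R0 - Cmod a))) in IB; [|lra|].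
  2: { intros t ht'. rewrite Cmod_mult.
       apply Rmult_le_compat; try apply Cmod_ge_0; [|apply Cmod_kern_le].
       unfold Cminus. eapply Rle_trans; [apply Cmod_triangle|].
       rewrite Cmod_opp.
       assert (h1 := hG u1 t ltac:(lra) ht'). assert (h2 := hG u2 t ltac:(lra) ht').
       replace (eps * s / M) with (eps * s / (2 * M) + eps * s / (2 * M)) by (field; lra).
       lra. }
  replace (boundary_integral u1 u2 t1 t2) with
    ((radial_integral u1 u2 t1 - radial_integral u1 u2 t2 - l * D) +
     (angular_integral u2 t1 t2 - angular_integral u1 t1 t2 + l * D))%C
    by (unfold boundary_integral; ring).
  eapply Rle_trans; [apply Cmod_triangle|].
  set (T := eps * s / M) in *.
  assert (hT : 0 <= T).
  { unfold T. apply Rdiv_le_0_compat; auto. apply Rmult_le_pos; lra. }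
  replace (eps * s ^ 2) with (s * (T * M)) by (unfold T; field; lra).
  set (q := R0 / (R0 - Cmod a)) in *.
  assert (h1 : 0 <= (u2 - u1) * (T * q))
    by (apply Rmult_le_pos; [lra|]; apply Rmult_le_pos; lra).
  assert (h2 : 0 <= (t2 - t1) * T) by (apply Rmult_le_pos; lra).
  unfold s, M. nra.
Qed.

Lemma boundary_integral_zero (u0 : R) : u0 <= 0 -> boundary_integral u0 0 0 (2 * PI) = 0%C.
Proof.
  intros hu0. assert (hpi := PI_RGT_0).
  apply additive_rectangle_function_zero; try lra.
  - intros u1 m u2 t1 n t2 h1 h2 h3 h4 h5 h6 h7 h8. unfold boundary_integral.
    rewrite (radial_integral_Chasles u1 m u2 t1), (radial_integral_Chasles u1 m u2 t2) by lra.
    rewrite (angular_integral_Chasles u1 t1 n t2), (angular_integral_Chasles u2 t1 n t2) by lra.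
    ring.
  - intros x y hx hy eps heps.
    destruct (boundary_integral_local x y ltac:(lra) eps heps) as [delta [hd h]].
    exists delta. auto.
Qed.

(** The sides t = 0 and t = 2 PI carry the same radial integral, so the vanishing boundary integral
    leaves only the difference of the angular ones. *)
Lemma angular_integral_const (u0 : R) : u0 <= 0 ->
  angular_integral u0 0 (2 * PI) = angular_integral 0 0 (2 * PI).
Proof.
  intros hu0. assert (h := boundary_integral_zero u0 hu0). unfold boundary_integral in h.
  assert (e : radial_integral u0 0 (2 * PI) = radial_integral u0 0 0).
  { assert (ec : cis (2 * PI) = cis 0)
      by (unfold cis; rewrite cos_2PI, sin_2PI, cos_0, sin_0; reflexivity).
    unfold radial_integral, pull_fun, pull, arm. rewrite ec. reflexivity. }
  rewrite e in h.
  replace (angular_integral u0 0 (2 * PI)) with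
    (angular_integral 0 0 (2 * PI) - (radial_integral u0 0 0 - radial_integral u0 0 0 +
       (angular_integral 0 0 (2 * PI) - angular_integral u0 0 (2 * PI))))%C by ring.
  rewrite h. ring.
Qed.

Lemma is_CInt_kern : is_CInt kern 0 (2 * PI) (CInt kern 0 (2 * PI)).
Proof.
  apply ccont_ex_CInt; [generalize PI_RGT_0; lra|]. intros t _. apply ccont_kern.
Qed.

(** The angular integral does not depend on [u]. At u = 0 it runs over the circle of radius [R0];
    for u very negative its integrand is uniformly close to [f a * kern t]. *)
Lemma Cauchy_kernel_formula :
  is_CInt (fun t => f (RtoC R0 * cis t) * kern t)%C 0 (2 * PI) (f a * CInt kern 0 (2 * PI))%C.
Proof.
  assert (hpi := PI_RGT_0).
  assert (e : angular_integral 0 0 (2 * PI) = (f a * CInt kern 0 (2 * PI))%C).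
  { cut (angular_integral 0 0 (2 * PI) - f a * CInt kern 0 (2 * PI) = 0)%C.
    { intros h. replace (angular_integral 0 0 (2 * PI)) with
        (angular_integral 0 0 (2 * PI) - f a * CInt kern 0 (2 * PI)
         + f a * CInt kern 0 (2 * PI))%C by ring.
      rewrite h. ring. }
    apply Cmod_eq_0.
    set (c := Cmod _).
    assert (hc : 0 <= c) by apply Cmod_ge_0.
    destruct (Req_dec c 0) as [|hne]; auto. exfalso.
    set (q := R0 / (R0 - Cmod a)).
    assert (hq : 0 < q) by (apply Rdiv_lt_0_compat; lra).
    assert (hfa := is_C_derive_iff f a).
    destruct (hf a ltac:(lra)) as [l hl]. rewrite hfa in hl. clear hfa.
    (* Tolerance 1 already gives the Lipschitz estimate |f(w) - f(a)| <= (1 + |l|) |w - a| near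
       [a]. *)
    destruct (hl 1 Rlt_0_1) as [d [hd hw]].
    set (N := 1 + Cmod l). assert (hN : 0 < N) by (unfold N; generalize (Cmod_ge_0 l); lra).
    (* Chosen so that the final bound 2 PI * eps * q equals c / 2, contradicting c > 0. *)
    set (eps := c / (4 * PI * q)).
    assert (heps : 0 < eps).
    { apply Rdiv_lt_0_compat; [lra|]. apply Rmult_lt_0_compat; lra. }
    (* The curve at level u = ln m lies within 2 R0 m of [a]. The three bounds keep it in the range
       of the Lipschitz estimate, make the variation of [f] at most [eps], and ensure ln m <= 0. *)
    set (m := Rmin (Rmin (d / (4 * R0)) (eps / (2 * R0 * N))) 1).
    assert (hm : 0 < m).
    { unfold m. repeat apply Rmin_pos; try lra; apply Rdiv_lt_0_compat; try lra.
      apply Rmult_lt_0_compat; lra. }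
    assert (hm1 : m <= d / (4 * R0))
      by (unfold m; eapply Rle_trans; [apply Rmin_l|]; apply Rmin_l).
    assert (hm2 : m <= eps / (2 * R0 * N))
      by (unfold m; eapply Rle_trans; [apply Rmin_l|]; apply Rmin_r).
    assert (hm3 : m <= 1) by apply Rmin_r.
    assert (hu0 : ln m <= 0).
    { rewrite <- ln_1. destruct hm3 as [h | ->]; [|lra]. left; now apply ln_increasing. }
    assert (I : is_CInt (fun t => (pull_fun (ln m) t - f a) * kern t)%C 0 (2 * PI)
                  (angular_integral (ln m) 0 (2 * PI) - f a * CInt kern 0 (2 * PI))%C).
    { apply is_CInt_ext with (fun t => pull_fun (ln m) t * kern t - f a * kern t)%C; [lra| |].
      - intros t _. ring.
      - apply is_CInt_minus; [apply is_CInt_angular; lra|]. apply is_CInt_mult_l, is_CInt_kern. }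
    apply Cmod_CInt_le_const with (M := eps * q) in I; [|lra|].
    - rewrite (angular_integral_const (ln m) hu0) in I. fold c in I.
      assert (2 * (eps * (2 * PI) * q) = c).
      { unfold eps. field. split; lra. }
      lra.
    - intros t _. rewrite Cmod_mult.
      apply Rmult_le_compat; try apply Cmod_ge_0; [|apply Cmod_kern_le].
      assert (hp : Cmod (pull (ln m) t) <= m * (2 * R0)).
      { unfold pull. rewrite Cmod_mult, Cmod_R, exp_ln, Rabs_pos_eq by lra.
        apply Rmult_le_compat_l; [lra|]. apply Cmod_arm_le. }
      assert (e : (a + pull (ln m) t - a)%C = pull (ln m) t) by ring.
      specialize (hw (a + pull (ln m) t)%C). rewrite e in hw.
      assert (hlt : Cmod (pull (ln m) t) < d).
      { eapply Rle_lt_trans; [exact hp|].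
        apply Rmult_le_compat_r with (r := 2 * R0) in hm1; [|lra].
        replace (d / (4 * R0) * (2 * R0)) with (d / 2) in hm1 by (field; lra). lra. }
      specialize (hw hlt). unfold pull_fun.
      replace (f (a + pull (ln m) t) - f a)%C
        with ((f (a + pull (ln m) t) - f a - pull (ln m) t * l) + pull (ln m) t * l)%C by ring.
      eapply Rle_trans; [apply Cmod_triangle|]. rewrite Cmod_mult.
      apply Rle_trans with (m * (2 * R0) * N).
      + unfold N. generalize (Cmod_ge_0 l). nra.
      + apply Rmult_le_compat_r with (r := 2 * R0 * N) in hm2;
          [|left; apply Rmult_lt_0_compat; lra].
        replace (eps / (2 * R0 * N) * (2 * R0 * N)) with eps in hm2 by (field; lra). lra. }
  rewrite <- e.
  apply is_CInt_ext with (fun t => pull_fun 0 t * kern t)%C; [lra| |apply is_CInt_angular; lra].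
  intros t _. unfold pull_fun, pull. rewrite exp_0.
  replace (a + RtoC 1 * arm t)%C with (RtoC R0 * cis t)%C by (unfold arm; ring).
  reflexivity.
Qed.

End Cauchy.

(** * Power series *)

Lemma is_Cseries_of_geometric_bound (u : nat -> C) (l : C) (M q : R) :
  0 <= q < 1 -> (forall N, Cmod (l - @sum_n C_AbelianMonoid u N) <= M * q ^ N) ->
  @is_series C_AbsRing C_NormedModule u l.
Proof.
  intros hq h.
  apply (proj2 (@filterlim_locally nat C_UniformSpace eventually _ (@sum_n C_AbelianMonoid u) l)).
  intros eps.
  assert (hM : 0 <= M).
  { specialize (h 0%nat). simpl in h. rewrite Rmult_1_r in h.
    eapply Rle_trans; [apply Cmod_ge_0 | exact h]. }
  destruct (pow_lt_1_zero q) with (y := eps / (M + 1)) as [N hN].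
  - rewrite Rabs_pos_eq; lra.
  - apply Rdiv_lt_0_compat; [apply cond_pos | lra].
  - exists N. intros n hn. specialize (hN n hn). specialize (h n).
    rewrite Rabs_pos_eq in hN by (apply pow_le; lra).
    apply (@norm_compat1 C_AbsRing C_NormedModule).
    change (Cmod (@sum_n C_AbelianMonoid u n - l) < eps).
    rewrite <- Cmod_opp, Copp_minus_distr.
    eapply Rle_lt_trans; [exact h|].
    apply Rmult_lt_compat_r with (r := M + 1) in hN; [|lra].
    replace (eps / (M + 1) * (M + 1)) with (pos eps) in hN by (field; lra).
    assert (0 <= q ^ n) by (apply pow_le; lra). nra.
Qed.

Lemma cis_neq_0 (t : R) : cis t <> 0%C.
Proof. apply Cmod_gt_0. rewrite Cmod_cis. lra. Qed.

Lemma cis_pow (t : R) (n : nat) : (cis t ^ n)%C = cis (INR n * t).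
Proof.
  induction n as [|n IH].
  - simpl. unfold cis. rewrite Rmult_0_l, cos_0, sin_0. reflexivity.
  - rewrite S_INR. change (cis t ^ S n)%C with (cis t * cis t ^ n)%C. rewrite IH.
    replace ((INR n + 1) * t) with (t + INR n * t) by ring.
    unfold cis, Cmult; simpl. rewrite cos_plus, sin_plus. f_equal; ring.
Qed.

Lemma cis_inv (t : R) : (/ cis t)%C = cis (- t).
Proof.
  assert (h := cis_neq_0 t).
  replace (cis (- t)) with (/ cis t * (cis t * cis (- t)))%C by (field; exact h).
  replace (cis t * cis (- t))%C with (RtoC 1); [ring|].
  unfold cis, Cmult; simpl. rewrite cos_neg, sin_neg.
  unfold RtoC. f_equal; [|ring]. rewrite <- (sin2_cos2 t). unfold Rsqr. ring.
Qed.

Lemma is_CInt_cis_inv_pow (n : nat) : (0 < n)%nat ->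
  is_CInt (fun t => / (cis t ^ n))%C 0 (2 * PI) (RtoC 0).
Proof.
  intros hn. assert (hN : INR n <> 0) by (apply not_0_INR; lia).
  apply (@is_RInt_ext C_R_NormedModule) with (fun t => (cos (INR n * t), - sin (INR n * t)) : C).
  { intros t _. rewrite cis_pow, cis_inv. unfold cis. now rewrite cos_neg, sin_neg. }
  assert (h := is_CInt_derive (fun t => sin (INR n * t) / INR n) (fun t => cos (INR n * t) / INR n)
    (fun t => cos (INR n * t)) (fun t => - sin (INR n * t)) 0 (2 * PI)).
  replace (RtoC 0) with ((sin (INR n * (2 * PI)) / INR n - sin (INR n * 0) / INR n,
                          cos (INR n * (2 * PI)) / INR n - cos (INR n * 0) / INR n) : C).
  - apply h.
    + intros t. auto_derive; auto. field. auto.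
    + intros t. auto_derive; auto. field. auto.
    + intros t. apply (continuous_comp (fun t => INR n * t) cos); [|apply continuous_cos].
      apply (@continuous_mult R_UniformSpace R_AbsRing);
        [apply continuous_const | apply continuous_id].
    + intros t. apply (@continuous_opp R_UniformSpace R_AbsRing R_NormedModule).
      apply (continuous_comp (fun t => INR n * t) sin); [|apply continuous_sin].
      apply (@continuous_mult R_UniformSpace R_AbsRing);
        [apply continuous_const | apply continuous_id].
  - replace (INR n * (2 * PI)) with (0 + 2 * INR n * PI) by ring.
    rewrite sin_period, cos_period, Rmult_0_r. unfold RtoC. f_equal; ring.
Qed.

(** * Expansion of Cauchy integrals over a circle in powers of the point [a] *)

Section CircleExpansion.

Variables (G : R -> C) (R0 : R) (a : C).
Hypothesis hR : 0 < R0.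
Hypothesis ha : Cmod a < R0.
Hypothesis hG : forall t, ccont G t.

(** This is G dw / w^(n+1) on the circle, since dw = i w dt. The usual factor 1 / (2 PI i) is left
    out and restored once [CInt_kern] is known. *)
Definition circle_integrand (n : nat) (t : R) : C := (Ci * G t * / (RtoC R0 * cis t) ^ n)%C.
Definition circle_coeff (n : nat) : C := CInt (circle_integrand n) 0 (2 * PI).

Lemma circle_neq_0 (t : R) : (RtoC R0 * cis t)%C <> 0%C.
Proof. apply Cmod_gt_0. rewrite Cmod_circle; lra. Qed.

Lemma ccont_circle_integrand (n : nat) (t : R) : ccont (circle_integrand n) t.
Proof.
  apply ccont_mult; [apply ccont_mult; [apply ccont_const | auto]|].
  apply (ccont_inv (fun t => (RtoC R0 * cis t) ^ n)%C).
  - apply ccont_pow. apply ccont_mult; [apply ccont_const | apply ccont_cis].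
  - apply Cpow_nz, circle_neq_0.
Qed.

Lemma is_CInt_circle_coeff (n : nat) :
  is_CInt (circle_integrand n) 0 (2 * PI) (circle_coeff n).
Proof.
  apply ccont_ex_CInt; [generalize PI_RGT_0; lra|]. intros t _. apply ccont_circle_integrand.
Qed.

(** With w on the circle, kern = i w / (w - a) satisfies kern = i + (a / w) kern. Iterating this
    identity gives the remainder exactly, so that the convergence of the series follows from the
    bound (|a| / R0)^(N+1) on its factor, with no interchange of sum and integral. *)
Lemma circle_expansion_remainder (l : C) (N : nat) :
  is_CInt (fun t => G t * kern R0 a t)%C 0 (2 * PI) l ->
  is_CInt (fun t => a ^ S N * / (RtoC R0 * cis t) ^ S N * (G t * kern R0 a t))%C 0 (2 * PI)
    (l - @sum_n C_AbelianMonoid (fun n => a ^ n * circle_coeff n)%C N)%C.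
Proof.
  intros hl. assert (hpi := PI_RGT_0).
  assert (step : forall n t,
    (a ^ S n * / (RtoC R0 * cis t) ^ S n * (G t * kern R0 a t) =
     a ^ n * / (RtoC R0 * cis t) ^ n * (G t * kern R0 a t) - a ^ n * circle_integrand n t)%C).
  { intros n t. assert (h1 := circle_neq_0 t). assert (h2 := arm_neq_0 R0 a hR ha t).
    unfold circle_integrand, kern, arm in *. set (w := (RtoC R0 * cis t)%C) in *.
    replace (RtoC R0 * (Ci * cis t))%C with (Ci * w)%C by (unfold w; ring).
    assert (h3 : (w ^ n)%C <> 0%C) by now apply Cpow_nz.
    rewrite !Cpow_S. field. repeat split; auto. }
  induction N as [|N IH].
  - rewrite sum_O.
    apply is_CInt_ext with (fun t => G t * kern R0 a t - a ^ 0 * circle_integrand 0 t)%C; [lra| |].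
    + intros t _. rewrite (step 0%nat t). simpl. field.
    + apply is_CInt_minus; auto. apply is_CInt_mult_l, is_CInt_circle_coeff.
  - rewrite sum_Sn.
    replace (l - plus (@sum_n C_AbelianMonoid (fun n => a ^ n * circle_coeff n)%C N)
                      (a ^ S N * circle_coeff (S N))%C)%C
      with (l - @sum_n C_AbelianMonoid (fun n => a ^ n * circle_coeff n)%C N
              - a ^ S N * circle_coeff (S N))%C.
    2: { unfold plus; simpl. ring. }
    eapply is_CInt_ext; [lra| |apply is_CInt_minus; [exact IH|]].
    + intros t _. rewrite (step (S N) t). reflexivity.
    + apply is_CInt_mult_l, is_CInt_circle_coeff.
Qed.

Lemma circle_expansion (l : C) :
  is_CInt (fun t => G t * kern R0 a t)%C 0 (2 * PI) l ->
  is_Cpseries circle_coeff a l.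
Proof.
  intros hl. assert (hpi := PI_RGT_0).
  set (q := Cmod a / R0). set (m := R0 / (R0 - Cmod a)).
  assert (ha0 := Cmod_ge_0 a).
  assert (hq : 0 <= q < 1).
  { unfold q. split; [apply Rdiv_le_0_compat; lra|].
    apply Rmult_lt_reg_r with R0; auto. unfold Rdiv. rewrite Rmult_assoc, Rinv_l; lra. }
  assert (exJ : ex_RInt (fun t => Cmod (G t)) 0 (2 * PI)).
  { apply (@ex_RInt_continuous R_CompleteNormedModule). intros t _.
    apply (continuous_comp G Cmod); auto.
    apply continuous_ext with (@norm R_AbsRing C_R_NormedModule).
    - intros z. symmetry. apply Cmod_norm.
    - apply filterlim_norm. }
  destruct exJ as [J hJ].
  unfold is_pseries.
  apply (@is_series_ext C_AbsRing C_NormedModule (fun n => a ^ n * circle_coeff n)%C).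
  { reflexivity. }
  apply is_Cseries_of_geometric_bound with (M := q * m * J) (q := q); auto.
  intros N.
  replace (q * m * J * q ^ N) with (q ^ S N * m * J) by (simpl; ring).
  assert (hrem := circle_expansion_remainder l N hl).
  apply (Cmod_CInt_le _ (fun t => q ^ S N * m * Cmod (G t)) 0 (2 * PI) _ (q ^ S N * m * J)) in hrem;
    [exact hrem|lra| |].
  - intros t _.
    rewrite !Cmod_mult, Cmod_inv, !Cmod_pow, Cmod_circle by (auto; apply Cpow_nz, circle_neq_0).
    rewrite <- pow_inv, <- Rpow_mult_distr. fold (Cmod a / R0). fold q.
    rewrite (Rmult_comm (Cmod (G t))), <- Rmult_assoc.
    apply Rmult_le_compat_r; [apply Cmod_ge_0|].
    apply Rmult_le_compat_l; [apply pow_le; lra|].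
    apply Cmod_kern_le; auto.
  - apply (@is_RInt_scal R_NormedModule); auto.
Qed.

End CircleExpansion.

Lemma is_Cseries_unique (u : nat -> C) (k l : C) :
  @is_series C_AbsRing C_NormedModule u k -> @is_series C_AbsRing C_NormedModule u l -> k = l.
Proof. apply (@filterlim_locally_unique nat C_AbsRing C_NormedModule eventually _). Qed.

(** The expansion for G = 1 has constant coefficient 2 PI i, and all its other coefficients are
    integrals of nontrivial powers of e^(it), hence 0. *)
Lemma CInt_kern (R0 : R) (a : C) : 0 < R0 -> Cmod a < R0 ->
  CInt (kern R0 a) 0 (2 * PI) = (RtoC (2 * PI) * Ci)%C.
Proof.
  intros hR ha. assert (hpi := PI_RGT_0).
  assert (h := circle_expansion (fun _ => RtoC 1) R0 a hR ha
    (fun t => ccont_const (RtoC 1) t) (CInt (kern R0 a) 0 (2 * PI))).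
  assert (h0 : is_CInt (fun t => 1 * kern R0 a t)%C 0 (2 * PI) (CInt (kern R0 a) 0 (2 * PI))).
  { eapply is_CInt_ext; [lra| |apply (is_CInt_kern R0 a hR ha)]. intros t _. ring. }
  specialize (h h0).
  apply (is_Cseries_unique _ _ _ h).
  (* Every partial sum already equals the limit, so the remainder bound is 0. *)
  apply is_Cseries_of_geometric_bound with (M := 0) (q := 0); [lra|].
  assert (c0 : circle_coeff (fun _ => RtoC 1) R0 0 = (RtoC (2 * PI) * Ci)%C).
  { eapply is_CInt_unique.
    - apply (is_CInt_circle_coeff (fun _ => RtoC 1) R0 hR). intros t; apply ccont_const.
    - apply is_CInt_ext with (fun _ => Ci); [lra| |].
      + intros t _. unfold circle_integrand. simpl. field.
      + replace (RtoC (2 * PI)) with (RtoC (2 * PI - 0)) by (f_equal; ring).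
        apply is_CInt_const. }
  assert (cS : forall n, circle_coeff (fun _ => RtoC 1) R0 (S n) = 0%C).
  { intros n. eapply is_CInt_unique.
    - apply (is_CInt_circle_coeff (fun _ => RtoC 1) R0 hR). intros t; apply ccont_const.
    - apply is_CInt_ext with (fun t => Ci * / RtoC R0 ^ S n * / (cis t ^ S n))%C; [lra| |].
      + intros t _. unfold circle_integrand. rewrite Cpow_mult_l. field.
        split; apply Cpow_nz; [apply cis_neq_0|].
        intros e. apply RtoC_inj in e. lra.
      + replace (RtoC 0) with (Ci * / RtoC R0 ^ S n * 0)%C by ring.
        apply is_CInt_mult_l, is_CInt_cis_inv_pow. lia. }
  intros N. rewrite Rmult_0_l. apply Req_le. rewrite <- Cmod_0. f_equal.
  induction N as [|N IH].
  - rewrite sum_O, c0. unfold scal; simpl. unfold mult; simpl. unfold one; simpl. ring.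
  - rewrite sum_Sn, cS. unfold scal, plus; simpl. unfold mult; simpl.
    rewrite Cmult_0_r, Cplus_0_r. exact IH.
Qed.

(** The coefficients depend only on the values of [f] on the circle, so one series serves all
    interior points; [PS_scal] restores the factor 1 / (2 PI i). *)
Lemma Cpseries_of_derivable_closed (f : C -> C) (R0 : R) : 0 < R0 ->
  (forall z, Cmod z <= R0 -> ex_C_derive f z) ->
  exists c, forall z, Cmod z < R0 -> is_Cpseries c z (f z).
Proof.
  intros hR hf. assert (hpi := PI_RGT_0).
  set (G := fun t => f (RtoC R0 * cis t)%C).
  assert (h2 : (RtoC (2 * PI) * Ci)%C <> 0%C).
  { apply Cmod_gt_0. rewrite Cmod_mult, Cmod_Ci, Cmod_R, Rabs_pos_eq; lra. }
  exists (@PS_scal C_AbsRing C_NormedModule (/ (RtoC (2 * PI) * Ci))%C (circle_coeff G R0)).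
  intros z hz.
  assert (hG : forall t, ccont G t).
  { intros t. apply (continuous_comp (fun t => RtoC R0 * cis t)%C f).
    - apply ccont_mult; [apply ccont_const | apply ccont_cis].
    - destruct (hf (RtoC R0 * cis t)%C) as [l hl]; [rewrite Cmod_circle; lra|].
      exact (is_C_derive_continuous _ _ _ hl). }
  assert (h := Cauchy_kernel_formula f R0 z hR hz hf).
  rewrite CInt_kern in h by auto.
  apply (circle_expansion G R0 z hR hz hG) in h.
  apply (@is_pseries_scal C_AbsRing C_NormedModule (/ (RtoC (2 * PI) * Ci))%C) in h.
  - replace (f z) with (/ (RtoC (2 * PI) * Ci) * (f z * (RtoC (2 * PI) * Ci)))%C; [exact h|].
    set (w := (RtoC (2 * PI) * Ci)%C) in *. field. exact h2.
  - apply Cmult_comm.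
Qed.

(** At real points a complex series splits into two real ones; this reduces the uniqueness of
    complex coefficients to real power series. *)
Lemma Cpseries_Re_Im (c : nat -> C) (x : R) (l : C) :
  is_Cpseries c (RtoC x) l ->
  is_pseries (fun n => fst (c n)) x (fst l) /\ is_pseries (fun n => snd (c n)) x (snd l).
Proof.
  intros h.
  assert (e : forall N,
    @sum_n C_AbelianMonoid (fun k => @scal C_AbsRing C_NormedModule (@pow_n C_AbsRing (RtoC x) k) (c k)) N
    = (sum_n (fun k => scal (pow_n x k) (fst (c k))) N,
       sum_n (fun k => scal (pow_n x k) (snd (c k))) N)).
  { assert (ek : forall k, @scal C_AbsRing C_NormedModule (@pow_n C_AbsRing (RtoC x) k) (c k)
        = (scal (pow_n x k) (fst (c k)), scal (pow_n x k) (snd (c k)))).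
    { intros k. change (@pow_n C_AbsRing (RtoC x) k) with (RtoC x ^ k)%C.
      change (pow_n x k) with (x ^ k). rewrite <- RtoC_pow. unfold scal; simpl.
      unfold mult; simpl. unfold Cmult; simpl. f_equal; ring. }
    induction N as [|N IH].
    - rewrite !sum_O. apply ek.
    - rewrite !sum_Sn, IH, ek. reflexivity. }
  split.
  - apply filterlim_ext with (fun N => fst (@sum_n C_AbelianMonoid
      (fun k => @scal C_AbsRing C_NormedModule (@pow_n C_AbsRing (RtoC x) k) (c k)) N)).
    { intros N. now rewrite e. }
    apply filterlim_comp with (1 := h).
    apply (@continuous_fst R_UniformSpace R_UniformSpace).
  - apply filterlim_ext with (fun N => snd (@sum_n C_AbelianMonoid
      (fun k => @scal C_AbsRing C_NormedModule (@pow_n C_AbsRing (RtoC x) k) (c k)) N)).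
    { intros N. now rewrite e. }
    apply filterlim_comp with (1 := h).
    apply (@continuous_snd R_UniformSpace R_UniformSpace).
Qed.

Lemma pseries_coeff_unique (a b : nat -> R) (rho : R) : 0 < rho ->
  (forall x, Rabs x < rho -> exists l : R, is_pseries a x l /\ is_pseries b x l) ->
  forall n, a n = b n.
Proof.
  intros hr h n.
  (* Uniqueness requires positive radii of convergence. Convergence at rho / 2 gives this, since the
     terms do not tend to 0 at a point beyond the radius. *)
  assert (cv : forall c : nat -> R, (forall x, Rabs x < rho -> exists l : R, is_pseries c x l) ->
    Rbar_lt 0 (CV_radius c)).
  { intros c hc. destruct (hc (rho / 2)) as [l hl]; [rewrite Rabs_pos_eq; lra|].
    apply Rbar_lt_le_trans with (Finite (Rabs (rho / 2))).
    - simpl. rewrite Rabs_pos_eq; lra.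
    - apply Rbar_not_lt_le. intros hlt. apply (CV_disk_outside c (rho / 2) hlt).
      apply ex_series_lim_0. exists l. apply is_pseries_R. exact hl. }
  apply PSeries_ext_recip.
  - apply cv. intros x hx. destruct (h x hx) as [l []]. eauto.
  - apply cv. intros x hx. destruct (h x hx) as [l []]. eauto.
  - exists (mkposreal rho hr). intros x hx.
    assert (hx' : Rabs x < rho).
    { change (Rabs (x + - 0) < rho) in hx. now rewrite Ropp_0, Rplus_0_r in hx. }
    destruct (h x hx') as [l [h1 h2]].
    rewrite (is_pseries_unique a x l h1). symmetry. exact (is_pseries_unique b x l h2).
Qed.

(** Each smaller radius yields its own coefficients. Any two families represent [f] on a common real
    interval around 0 and so coincide; those found for r / 2 therefore work throughout. *)
Lemma Cpseries_of_derivable (f : C -> C) (r : R) : 0 < r ->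
  (forall z, Cmod z < r -> ex_C_derive f z) ->
  exists c, forall z, Cmod z < r -> is_Cpseries c z (f z).
Proof.
  intros hr hf.
  assert (ex : forall R0, 0 < R0 < r -> exists c, forall z, Cmod z < R0 -> is_Cpseries c z (f z)).
  { intros R0 h. apply Cpseries_of_derivable_closed; [lra|]. intros z hz. apply hf. lra. }
  destruct (ex (r / 2)) as [c hc]; [lra|].
  exists c. intros z hz. assert (h0 := Cmod_ge_0 z).
  destruct (ex ((Cmod z + r) / 2)) as [d hd]; [lra|].
  assert (e : forall n, d n = c n).
  { set (m := Rmin (r / 2) ((Cmod z + r) / 2)).
    assert (hm : 0 < m) by (apply Rmin_pos; lra).
    assert (both : forall x, Rabs x < m ->
      is_Cpseries d (RtoC x) (f (RtoC x)) /\ is_Cpseries c (RtoC x) (f (RtoC x))).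
    { intros x hx. split; [apply hd | apply hc]; rewrite Cmod_R;
        eapply Rlt_le_trans; [exact hx| |exact hx|]; [apply Rmin_r | apply Rmin_l]. }
    intros n. apply injective_projections.
    - apply (pseries_coeff_unique (fun n => fst (d n)) (fun n => fst (c n)) m hm).
      intros x hx. destruct (both x hx) as [h1 h2]. eexists.
      split; apply Cpseries_Re_Im; eassumption.
    - apply (pseries_coeff_unique (fun n => snd (d n)) (fun n => snd (c n)) m hm).
      intros x hx. destruct (both x hx) as [h1 h2]. eexists.
      split; apply Cpseries_Re_Im; eassumption. }
  apply (@is_pseries_ext C_AbsRing C_NormedModule d c z (f z) e).
  apply hd. lra.
Qed.

Lemma Cmod_lim_le (u : nat -> C) (l : C) (B : R) :
  filterlim u eventually (@locally C_UniformSpace l) -> (forall n, Cmod (u n) <= B) -> Cmod l <= B.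
Proof.
  intros hu hB.
  assert (h : is_lim_seq (fun n => Cmod (u n)) (Cmod l)).
  { apply filterlim_comp with (1 := hu). apply (@filterlim_norm C_AbsRing C_NormedModule). }
  apply (is_lim_seq_le _ _ _ _ hB h (is_lim_seq_const B)).
Qed.

(** Each term is a difference of two consecutive partial sums, which are bounded by convergence;
    this gives the factor 2. *)
Lemma Cpseries_coeff_bound (c : nat -> C) (w l : C) :
  is_Cpseries c w l -> exists M, forall n, Cmod (c n) * Cmod w ^ n <= M.
Proof.
  intros h.
  destruct (@filterlim_bounded C_AbsRing C_NormedModule _ (ex_intro _ l h)) as [M hM].
  exists (2 * M). intros n.
  assert (h0 := hM 0%nat). assert (hn := hM n).
  change (Cmod (@sum_n C_AbelianMonoid (fun k => w ^ k * c k)%C 0) <= M) in h0.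
  change (Cmod (@sum_n C_AbelianMonoid (fun k => w ^ k * c k)%C n) <= M) in hn.
  replace (Cmod (c n) * Cmod w ^ n) with (Cmod (w ^ n * c n)) by (rewrite Cmod_mult, Cmod_pow; ring).
  destruct n as [|n].
  - rewrite sum_O in h0. generalize (Cmod_ge_0 (w ^ 0 * c 0%nat)). lra.
  - assert (hp := hM n).
    change (Cmod (@sum_n C_AbelianMonoid (fun k => w ^ k * c k)%C n) <= M) in hp.
    rewrite sum_Sn in hn. unfold plus in hn; simpl in hn.
    set (s := @sum_n C_AbelianMonoid (fun k => w ^ k * c k)%C n) in *.
    change (w * w ^ n)%C with (w ^ S n)%C in hn.
    replace (w ^ S n * c (S n))%C with (s + w ^ S n * c (S n) + - s)%C by ring.
    eapply Rle_trans; [apply Cmod_triangle|]. rewrite Cmod_opp. lra.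
Qed.

Lemma Cmod_pseries_le (c : nat -> C) (z l : C) (rho M q : R) : 0 <= q < 1 ->
  (forall n, Cmod (c n) * rho ^ n <= M) -> Cmod z <= q * rho -> 0 < rho ->
  is_Cpseries c z l -> Cmod l <= M / (1 - q).
Proof.
  intros hq hM hz hr h.
  assert (hM0 : 0 <= M).
  { specialize (hM 0%nat). simpl in hM. generalize (Cmod_ge_0 (c 0%nat)). lra. }
  apply (Cmod_lim_le _ _ _ h). intros N.
  apply Rle_trans with (M * (1 - q ^ S N) / (1 - q)).
  - assert (term : forall n, Cmod (z ^ n * c n) <= M * q ^ n).
    { intros n. rewrite Cmod_mult, Cmod_pow.
      apply Rle_trans with ((q * rho) ^ n * Cmod (c n)).
      - apply Rmult_le_compat_r; [apply Cmod_ge_0|]. apply pow_incr.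
        split; [apply Cmod_ge_0 | auto].
      - rewrite Rpow_mult_distr. specialize (hM n).
        assert (0 <= q ^ n) by (apply pow_le; lra). nra. }
    change (Cmod (@sum_n C_AbelianMonoid (fun k => z ^ k * c k)%C N) <= M * (1 - q ^ S N) / (1 - q)).
    induction N as [|N IH].
    + rewrite sum_O. eapply Rle_trans; [apply term|]. right. simpl. field. lra.
    + rewrite sum_Sn. unfold plus; simpl.
      eapply Rle_trans; [apply Cmod_triangle|].
      apply Rle_trans with (M * (1 - q ^ S N) / (1 - q) + M * q ^ S N).
      * apply Rplus_le_compat; [exact IH | apply (term (S N))].
      * right. simpl. field. lra.
  - unfold Rdiv. apply Rmult_le_compat_r; [left; apply Rinv_0_lt_compat; lra|].
    assert (0 <= q ^ S N) by (apply pow_le; lra). nra.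
Qed.

(** * Complex derivatives and division by z - a *)

Lemma is_C_derive_inv_minus (a z : C) : z <> a ->
  is_C_derive (fun w => / (w - a))%C z (- / ((z - a) * (z - a)))%C.
Proof.
  intros hz. apply is_C_derive_iff.
  assert (hza : (z - a)%C <> 0%C).
  { intros e. apply hz. replace z with (z - a + a)%C by ring. rewrite e. ring. }
  set (d := Cmod (z - a)). assert (hd : 0 < d) by now apply Cmod_gt_0.
  intros eps heps.
  (* The remainder is (w - z)^2 / ((w - a) (z - a)^2). The first bound gives |w - a| >= d / 2, the
     second makes |w - z| at most eps times the resulting lower bound d^3 / 2 of the denominator. *)
  exists (Rmin (d / 2) (eps * d ^ 3 / 2)). split.
  { apply Rmin_pos; [lra|]. assert (0 < d ^ 3) by (apply pow_lt; auto). nra. }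
  intros w hw.
  assert (hw1 : Cmod (w - z) < d / 2) by (eapply Rlt_le_trans; [exact hw | apply Rmin_l]).
  assert (hw2 : Cmod (w - z) < eps * d ^ 3 / 2) by (eapply Rlt_le_trans; [exact hw | apply Rmin_r]).
  assert (hwa : d / 2 <= Cmod (w - a)).
  { assert (h := Cmod_triangle (w - a) (- (w - z))).
    replace (w - a + - (w - z))%C with (z - a)%C in h by ring.
    rewrite Cmod_opp in h. fold d in h. lra. }
  assert (hwa0 : (w - a)%C <> 0%C) by (apply Cmod_gt_0; lra).
  replace (/ (w - a) - / (z - a) - (w - z) * - / ((z - a) * (z - a)))%C
    with ((w - z) * ((w - z) / ((w - a) * ((z - a) * (z - a)))))%C by (field; auto).
  assert (hne : ((w - a) * ((z - a) * (z - a)))%C <> 0%C) by now repeat apply Cmult_neq_0.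
  rewrite Cmod_mult, Cmod_div by exact hne. rewrite !Cmod_mult. fold d.
  rewrite Rmult_comm. apply Rmult_le_compat_r; [apply Cmod_ge_0|].
  assert (hp : 0 < Cmod (w - a) * (d * d)) by (repeat apply Rmult_lt_0_compat; lra).
  apply Rmult_le_reg_r with (Cmod (w - a) * (d * d)); auto.
  unfold Rdiv. rewrite Rmult_assoc, Rinv_l, Rmult_1_r by lra.
  apply Rle_trans with (eps * (d / 2 * (d * d))); [simpl in hw2; lra|].
  apply Rmult_le_compat_l; [lra|]. apply Rmult_le_compat_r; [nra | auto].
Qed.

(** C is a module over itself in two ways, with different uniform structures, and the product rule
    is stated for the one that comes from the absolute value. The estimates in the two derivatives
    are the same; only the record of linearity has to be rebuilt. *)
Lemma is_C_derive_AbsRing (f : C -> C) (z l : C) :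
  @is_derive C_AbsRing (AbsRing_NormedModule C_AbsRing) f z l <-> is_C_derive f z l.
Proof. split; intros [[h1 h2 h3] h]; split; [now constructor | exact h | now constructor | exact h]. Qed.

Lemma is_C_derive_mult (f g : C -> C) (z k l : C) :
  is_C_derive f z k -> is_C_derive g z l ->
  is_C_derive (fun w => f w * g w)%C z (k * g z + f z * l)%C.
Proof.
  intros hf hg. apply is_C_derive_AbsRing in hf, hg. apply is_C_derive_AbsRing.
  exact (@is_derive_mult C_AbsRing f g z k l hf hg Cmult_comm).
Qed.

Lemma C_eq_dec (z w : C) : {z = w} + {z <> w}.
Proof.
  destruct z as [a b], w as [c d].
  destruct (Req_EM_T a c) as [->|h]; [destruct (Req_EM_T b d) as [->|h]|].
  - now left.
  - right. congruence.
  - right. congruence.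
Qed.

Lemma ex_C_derive_shift (f : C -> C) (a w : C) :
  ex_C_derive f (a + w)%C -> ex_C_derive (fun w => f (a + w)%C) w.
Proof.
  intros [l hl]. exists l. rewrite is_C_derive_iff in *. intros eps heps.
  destruct (hl eps heps) as [d [hd h]]. exists d. split; auto. intros v hv.
  specialize (h (a + v)%C).
  replace (a + v - (a + w))%C with (v - w)%C in h by ring. auto.
Qed.

Lemma ex_C_derive_minus_const (f : C -> C) (c z : C) :
  ex_C_derive f z -> ex_C_derive (fun w => f w - c)%C z.
Proof.
  intros [l hl]. exists l. rewrite is_C_derive_iff in *. intros eps heps.
  destruct (hl eps heps) as [d [hd h]]. exists d. split; auto. intros v hv.
  replace (f v - c - (f z - c))%C with (f v - f z)%C by ring. auto.
Qed.

(** Away from [a] the quotient is differentiable by the product rule. At [a] the power series is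
    needed: f = c0 + c1 w + c2 w^2 + w^3 L with w = z - a and L bounded, so the quotient, completed
    by c1, has derivative c2. *)
Lemma divided_difference (f : C -> C) (a : C) : Cmod a < 1 ->
  (forall z, Cmod z < 1 -> ex_C_derive f z) ->
  exists g : C -> C, (forall z, f z = f a + (z - a) * g z)%C /\
    (forall z, Cmod z < 1 -> ex_C_derive g z).
Proof.
  intros ha hf.
  set (rho := 1 - Cmod a).
  assert (hrho : 0 < rho) by (unfold rho; lra).
  destruct (Cpseries_of_derivable (fun w => f (a + w)%C) rho hrho) as [c hc].
  { intros w hw. apply ex_C_derive_shift, hf.
    eapply Rle_lt_trans; [apply Cmod_triangle|]. unfold rho in hw; lra. }
  assert (hc0 : c 0%nat = f a).
  { assert (h := hc (RtoC 0)). rewrite Cmod_0 in h. specialize (h hrho).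
    rewrite Cplus_0_r in h. symmetry.
    apply (is_Cseries_unique _ _ _ h). apply (@is_pseries_0 C_AbsRing C_NormedModule). }
  set (g := fun z => if C_eq_dec z a then c 1%nat else ((f z - f a) / (z - a))%C).
  assert (sub0 : forall z, z <> a -> (z - a)%C <> 0%C).
  { intros z hz e. apply hz. replace z with (z - a + a)%C by ring. rewrite e. ring. }
  exists g. split.
  { intros z. unfold g. destruct (C_eq_dec z a) as [->|hz]; [ring|].
    field. auto. }
  intros z hz. destruct (C_eq_dec z a) as [->|hza].
  - exists (c 2%nat). apply is_C_derive_iff.
    destruct (Cpseries_coeff_bound c (RtoC (rho / 2)) (f (a + RtoC (rho / 2))%C)) as [M hM].
    { apply hc. rewrite Cmod_R, Rabs_pos_eq; lra. }
    rewrite Cmod_R, Rabs_pos_eq in hM by lra.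
    (* A bound for L: the coefficients shifted by three are controlled at radius rho / 2 by M / (rho
       / 2)^3, and |w| < rho / 4 gives ratio 1/2, hence the factor 2. *)
    set (K := 2 * M / (rho / 2) ^ 3).
    assert (hr3 : 0 < (rho / 2) ^ 3) by (apply pow_lt; lra).
    assert (hM0 : 0 <= M).
    { specialize (hM 0%nat). simpl in hM. generalize (Cmod_ge_0 (c 0%nat)). lra. }
    assert (hK : 0 <= K) by (unfold K; apply Rdiv_le_0_compat; lra).
    intros eps heps. exists (Rmin (rho / 4) (eps / (K + 1))). split.
    { apply Rmin_pos; [lra|]. apply Rdiv_lt_0_compat; lra. }
    intros v hv.
    assert (hv1 : Cmod (v - a) < rho / 4) by (eapply Rlt_le_trans; [exact hv | apply Rmin_l]).
    assert (hv2 : Cmod (v - a) < eps / (K + 1)) by (eapply Rlt_le_trans; [exact hv | apply Rmin_r]).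
    unfold g at 2. destruct (C_eq_dec a a) as [_|]; [|congruence].
    unfold g. destruct (C_eq_dec v a) as [->|hva].
    { replace (c 1%nat - c 1%nat - (a - a) * c 2%nat)%C with (RtoC 0) by ring.
      rewrite Cmod_0. apply Rmult_le_pos; [lra | apply Cmod_ge_0]. }
    set (w := (v - a)%C) in *. assert (hw0 : w <> 0%C) by now apply sub0.
    assert (hs : is_Cpseries c w (f v)).
    { replace v with (a + w)%C by (unfold w; ring). apply hc. lra. }
    assert (inv : @mult C_AbsRing (/ w)%C w = @one C_AbsRing) by now apply Cinv_l.
    assert (h1 := @is_pseries_decr_1 C_AbsRing C_NormedModule _ _ _ _ inv hs).
    assert (h2 := @is_pseries_decr_1 C_AbsRing C_NormedModule _ _ _ _ inv h1).
    assert (h3 := @is_pseries_decr_1 C_AbsRing C_NormedModule _ _ _ _ inv h2).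
    set (L := (/ w * (/ w * (/ w * (f v + - c 0%nat) + - c 1%nat) + - c 2%nat))%C).
    assert (hL : Cmod L <= K).
    { replace K with ((M / (rho / 2) ^ 3) / (1 - / 2)) by (unfold K; field; lra).
      apply (Cmod_pseries_le (PS_decr_1 (PS_decr_1 (PS_decr_1 c))) w L (rho / 2)).
      - lra.
      - intros n. unfold PS_decr_1. specialize (hM (S (S (S n)))).
        apply Rmult_le_reg_r with ((rho / 2) ^ 3); auto.
        replace (M / (rho / 2) ^ 3 * (rho / 2) ^ 3) with M by (field; lra).
        simpl in *. lra.
      - lra.
      - lra.
      - exact h3. }
    replace ((f v - f a) / w - c 1%nat - w * c 2%nat)%C with (w * (w * L))%C
      by (unfold L; rewrite hc0; field; exact hw0).
    rewrite !Cmod_mult, Rmult_comm. apply Rmult_le_compat_r; [apply Cmod_ge_0|].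
    apply Rmult_lt_compat_r with (r := K + 1) in hv2; [|lra].
    replace (eps / (K + 1) * (K + 1)) with eps in hv2 by (field; lra).
    assert (h0 := Cmod_ge_0 w). assert (h00 := Cmod_ge_0 L). nra.
  - destruct (ex_C_derive_minus_const f (f a) z (hf z hz)) as [l hl].
    eexists. eapply (@is_derive_ext_loc C_AbsRing C_NormedModule).
    2: exact (is_C_derive_mult _ _ _ _ _ hl (is_C_derive_inv_minus a z hza)).
    assert (hd : 0 < Cmod (z - a)) by (apply Cmod_gt_0; auto).
    exists (mkposreal _ hd). intros v hv.
    change (Cmod (v - z) < Cmod (z - a)) in hv.
    unfold g. destruct (C_eq_dec v a) as [->|]; auto.
    exfalso. rewrite <- Cmod_opp, Copp_minus_distr in hv. lra.
Qed.

(** * The algebra F^p *)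

Lemma Cmod_disk_val (z : Disk) : Cmod (disk_val z) < 1.
Proof. exact (proj2_sig z). Qed.

Lemma extend_disk_val (f : Disk -> C) (z : Disk) : extend f (disk_val z) = f z.
Proof.
  destruct z as [z hz]. unfold extend. simpl.
  destruct (Rlt_dec (Cmod z) 1) as [h|]; [|contradiction].
  f_equal. f_equal. apply proof_irrelevance.
Qed.

Lemma Cmod_lt_1_locally (z : C) : Cmod z < 1 ->
  @locally (AbsRing_UniformSpace C_AbsRing) z (fun w : C => Cmod w < 1).
Proof.
  intros hz. assert (h : 0 < 1 - Cmod z) by lra.
  exists (mkposreal _ h). intros w hw. change (Cmod (w - z) < 1 - Cmod z) in hw.
  replace w with (w - z + z)%C by ring.
  eapply Rle_lt_trans; [apply Cmod_triangle|]. lra.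
Qed.

Lemma holomorphic_restriction (f : Disk -> C) (H : C -> C) :
  (forall z : Disk, f z = H (disk_val z)) ->
  (forall z, Cmod z < 1 -> ex_C_derive H z) -> holomorphic f.
Proof.
  intros e hH z. apply (@ex_derive_ext_loc C_AbsRing C_NormedModule H).
  - destruct (Cmod_lt_1_locally (disk_val z) (Cmod_disk_val z)) as [d hd].
    exists d. intros w hw. specialize (hd w hw).
    symmetry. transitivity (f (exist _ w hd)); [exact (extend_disk_val f (exist _ w hd)) | apply e].
  - apply hH, Cmod_disk_val.
Qed.

Lemma holomorphic_extend (f : Disk -> C) (z : C) :
  holomorphic f -> Cmod z < 1 -> ex_C_derive (extend f) z.
Proof. intros hf hz. exact (hf (exist _ z hz)). Qed.

Lemma holomorphic_fminus (f g : Disk -> C) :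
  holomorphic f -> holomorphic g -> holomorphic (fminus f g).
Proof.
  intros hf hg.
  apply (holomorphic_restriction _ (fun z => extend f z - extend g z)%C).
  - intros z. now rewrite !extend_disk_val.
  - intros z hz. apply (@ex_derive_minus C_AbsRing C_NormedModule);
      now apply holomorphic_extend.
Qed.

(** The choice in [taylor] is meaningful only once some expansion exists, and this is what Cauchy's
    formula provides. *)
Lemma power_expansion_taylor (f : Disk -> C) : holomorphic f -> power_expansion f (taylor f).
Proof.
  intros hf. unfold taylor. apply epsilon_spec.
  destruct (Cpseries_of_derivable (extend f) 1 Rlt_0_1) as [c hc].
  { intros z hz. now apply holomorphic_extend. }
  exists c. intros z. rewrite <- (extend_disk_val f z). apply hc, Cmod_disk_val.
Qed.

(** In place of compactness: the coefficients are bounded at the radius halfway between [r] and 1,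
    and on |z| <= r the series is dominated by a geometric one. *)
Lemma holomorphic_bounded (f : Disk -> C) (r : R) : holomorphic f -> 0 <= r < 1 ->
  exists B, forall z : Disk, Cmod (disk_val z) <= r -> Cmod (f z) <= B.
Proof.
  intros hf hr. set (rho := (1 + r) / 2).
  assert (hrho : Cmod (RtoC rho) < 1) by (unfold rho; rewrite Cmod_R, Rabs_pos_eq; lra).
  assert (ht := power_expansion_taylor f hf).
  destruct (Cpseries_coeff_bound _ _ _ (ht (exist _ _ hrho))) as [M hM].
  simpl in hM. rewrite Cmod_R, Rabs_pos_eq in hM by (unfold rho; lra).
  exists (M / (1 - r / rho)). intros z hz.
  apply (Cmod_pseries_le (taylor f) (disk_val z) (f z) rho M (r / rho)).
  - unfold rho. split; [apply Rdiv_le_0_compat; lra|].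
    apply Rmult_lt_reg_r with ((1 + r) / 2); [lra|].
    replace (r / ((1 + r) / 2) * ((1 + r) / 2)) with r by (field; lra). lra.
  - exact hM.
  - replace (r / rho * rho) with r by (unfold rho; field; lra). exact hz.
  - unfold rho; lra.
  - apply ht.
Qed.

Lemma origin_in_disk : Cmod (RtoC 0) < 1.
Proof. rewrite Cmod_0. lra. Qed.

(** [real] sends infinite values to 0, so the supremum must first be shown finite: the bound [B]
    excludes +oo, and the value at the origin excludes -oo. *)
Lemma M_infty_is_lub (f : Disk -> C) (r B : R) : 0 <= r ->
  (forall z : Disk, Cmod (disk_val z) <= r -> Cmod (f z) <= B) ->
  M_infty r f <= B /\ (forall z : Disk, Cmod (disk_val z) <= r -> Cmod (f z) <= M_infty r f).
Proof.
  intros hr hB. unfold M_infty.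
  set (S := fun x => exists z : Disk, Cmod (disk_val z) <= r /\ x = Cmod (f z)).
  destruct (Lub_Rbar_correct S) as [ub lub].
  set (o := exist _ _ origin_in_disk : Disk).
  assert (ho : S (Cmod (f o))) by (exists o; simpl; rewrite Cmod_0; auto).
  assert (hle : Rbar_le (Lub_Rbar S) B) by (apply lub; intros x [z [hz ->]]; now apply hB).
  specialize (ub _ ho) as hge.
  destruct (Lub_Rbar S) as [m| |]; simpl in *; try contradiction.
  split; auto. intros z hz. apply (ub (Cmod (f z))). now exists z.
Qed.

Lemma M_infty_le (f : Disk -> C) (r B : R) : 0 <= r ->
  (forall z : Disk, Cmod (disk_val z) <= r -> Cmod (f z) <= B) -> M_infty r f <= B.
Proof. intros hr hB. now apply M_infty_is_lub. Qed.

Lemma Cmod_le_M_infty (f : Disk -> C) (r : R) (z : Disk) :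
  holomorphic f -> 0 <= r < 1 -> Cmod (disk_val z) <= r -> Cmod (f z) <= M_infty r f.
Proof.
  intros hf hr hz. destruct (holomorphic_bounded f r hf hr) as [B hB].
  apply (M_infty_is_lub f r B); auto; lra.
Qed.

(** * Growth criteria for membership in F^p *)

Lemma log_plus_ge_0 (x : R) : 0 <= log_plus x.
Proof. apply Rmax_r. Qed.

Lemma ln_nonpos (x : R) : x <= 0 -> ln x = 0.
Proof.
  intros h. unfold ln. destruct (Rlt_dec 0 x) as [h'|]; [|reflexivity]. exfalso. lra.
Qed.

Lemma log_plus_le (x y : R) : x <= y -> log_plus x <= log_plus y.
Proof.
  intros hxy. unfold log_plus. destruct (Rle_dec x 0) as [hx|hx].
  - rewrite (ln_nonpos x hx), Rmax_left by lra. apply Rmax_r.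
  - apply Rle_max_compat_r. destruct hxy as [h| ->]; [|lra].
    left. apply ln_increasing; lra.
Qed.

(** It rests on A + B x <= (A + B + 1) max(x, 1) and log^+ x = ln (max(x, 1)); the added 1 makes the
    first logarithm nonnegative. *)
Lemma log_plus_affine_le (A B x : R) : 0 <= A -> 0 <= B -> 0 <= x ->
  log_plus (A + B * x) <= ln (A + B + 1) + log_plus x.
Proof.
  intros hA hB hx.
  assert (h1 : 0 <= ln (A + B + 1)).
  { rewrite <- ln_1. destruct (Req_dec (A + B + 1) 1) as [->|h]; [lra|].
    left; apply ln_increasing; lra. }
  assert (h2 := log_plus_ge_0 x).
  apply Rmax_lub; [|lra].
  destruct (Rle_dec (A + B * x) 0) as [h|h].
  { rewrite (ln_nonpos _ h). lra. }
  assert (e : log_plus x = ln (Rmax x 1)).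
  { unfold log_plus. destruct (Rle_dec x 1) as [hx1|hx1].
    - rewrite (Rmax_right x 1), ln_1 by lra. apply Rmax_right.
      destruct (Rle_dec x 0) as [hx0|hx0].
      + rewrite (ln_nonpos _ hx0). lra.
      + rewrite <- ln_1. destruct hx1 as [hx1| ->]; [|lra]. left; apply ln_increasing; lra.
    - rewrite (Rmax_left x 1) by lra. apply Rmax_left.
      rewrite <- ln_1. left; apply ln_increasing; lra. }
  assert (m1 := Rmax_l x 1). assert (m2 := Rmax_r x 1).
  rewrite e, <- ln_mult by lra.
  assert (hle : A + B * x <= (A + B + 1) * Rmax x 1) by nra.
  destruct hle as [hlt| ->]; [|lra]. left; apply ln_increasing; lra.
Qed.

Lemma filterlim_at_left_1_iff (phi : R -> R) :
  filterlim phi (at_left 1) (locally 0) <->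
  forall eps, 0 < eps -> exists delta, 0 < delta /\
    forall r, 1 - delta < r < 1 -> Rabs (phi r) < eps.
Proof.
  split.
  - intros h eps heps.
    assert (h' := proj1 (@filterlim_locally R R_UniformSpace (at_left 1) _ phi 0) h
      (mkposreal eps heps)).
    destruct h' as [d hd]. exists d. split; [apply cond_pos|]. intros r hr.
    assert (hb : ball 0 eps (phi r)).
    { apply hd; [|lra]. change (Rabs (r - 1) < d). apply Rabs_def1; lra. }
    change (Rabs (phi r - 0) < eps) in hb. now rewrite Rminus_0_r in hb.
  - intros h. apply (proj2 (@filterlim_locally R R_UniformSpace (at_left 1) _ phi 0)).
    intros eps. destruct (h eps (cond_pos eps)) as [d [hd hr]].
    exists (mkposreal d hd). intros r hb hlt.
    change (Rabs (r - 1) < d) in hb. apply Rabs_def2 in hb.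
    change (Rabs (phi r - 0) < eps). rewrite Rminus_0_r. apply hr. lra.
Qed.

Lemma Rpower_small (s eps : R) : 0 < s -> 0 < eps ->
  exists delta, 0 < delta /\ forall x, 0 < x < delta -> Rpower x s < eps.
Proof.
  intros hs heps. exists (Rpower eps (/ s)). split; [apply exp_pos|].
  intros x hx. replace eps with (Rpower (Rpower eps (/ s)) s).
  - apply Rlt_Rpower_l; auto.
  - rewrite Rpower_mult, Rinv_l, Rpower_1; lra.
Qed.

(** Passing from [f] to [h] adds at most the constant ln (A + B + 1) to log^+ M, and the weight (1 -
    r)^(1/p) sends that constant to 0. *)
Lemma in_Fp_of_affine_bound (p A B : R) (f h : Disk -> C) : 1 < p -> 0 <= A -> 0 <= B ->
  in_Fp p f -> holomorphic h -> (forall z, Cmod (h z) <= A + B * Cmod (f z)) -> in_Fp p h.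
Proof.
  intros hp hA hB [hf hlim] hh hle. split; auto.
  rewrite filterlim_at_left_1_iff in *. intros eps heps.
  destruct (hlim (eps / 2)) as [d1 [hd1 h1]]; [lra|].
  assert (hln : 0 <= ln (A + B + 1)).
  { rewrite <- ln_1. destruct (Req_dec (A + B + 1) 1) as [->|hne]; [lra|].
    left; apply ln_increasing; lra. }
  destruct (Rpower_small (1 / p) (eps / (2 * (ln (A + B + 1) + 1)))) as [d2 [hd2 h2]].
  { apply Rdiv_lt_0_compat; lra. }
  { apply Rdiv_lt_0_compat; lra. }
  exists (Rmin (Rmin d1 d2) 1). split; [repeat apply Rmin_pos; lra|].
  intros r hr.
  assert (m1 := Rmin_l (Rmin d1 d2) 1). assert (m2 := Rmin_r (Rmin d1 d2) 1).
  assert (m3 := Rmin_l d1 d2). assert (m4 := Rmin_r d1 d2).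
  specialize (h1 r ltac:(lra)). specialize (h2 (1 - r) ltac:(lra)).
  set (w := Rpower (1 - r) (1 / p)) in *.
  assert (hw : 0 < w) by apply exp_pos.
  rewrite Rabs_pos_eq in * by (apply Rmult_le_pos; [lra | apply log_plus_ge_0]).
  assert (hM0 : 0 <= M_infty r f).
  { eapply Rle_trans; [apply Cmod_ge_0|].
    apply (Cmod_le_M_infty f r (exist _ _ origin_in_disk)); auto; try lra.
    simpl. rewrite Cmod_0. lra. }
  assert (hM : M_infty r h <= A + B * M_infty r f).
  { apply M_infty_le; [lra|]. intros z hz. eapply Rle_trans; [apply hle|].
    apply Rplus_le_compat_l, Rmult_le_compat_l; auto. apply Cmod_le_M_infty; auto; lra. }
  assert (hL : log_plus (M_infty r h) <= ln (A + B + 1) + log_plus (M_infty r f)).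
  { eapply Rle_trans; [apply log_plus_le, hM|]. now apply log_plus_affine_le. }
  assert (hw2 : w * (ln (A + B + 1) + 1) < eps / 2).
  { apply Rmult_lt_compat_r with (r := ln (A + B + 1) + 1) in h2; [|lra].
    replace (eps / (2 * (ln (A + B + 1) + 1)) * (ln (A + B + 1) + 1)) with (eps / 2) in h2
      by (field; lra).
    exact h2. }
  apply Rle_lt_trans with (w * (ln (A + B + 1) + log_plus (M_infty r f))).
  - apply Rmult_le_compat_l; lra.
  - lra.
Qed.

(** Growth like a simple pole on the unit circle makes log^+ M at most ln (1 / (1 - r)). The
    exponent 1/p is split into two halves [s]: one absorbs the logarithm, the other tends to 0. *)
Lemma in_Fp_of_pole_bound (p : R) (h : Disk -> C) : 1 < p -> holomorphic h ->
  (forall z : Disk, Cmod (h z) <= / (1 - Cmod (disk_val z))) -> in_Fp p h.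
Proof.
  intros hp hh hle. split; auto.
  apply filterlim_at_left_1_iff. intros eps heps.
  set (s := / (2 * p)). assert (hs : 0 < s) by (apply Rinv_0_lt_compat; lra).
  destruct (Rpower_small s (eps * s)) as [d [hd hsm]]; auto.
  { apply Rmult_lt_0_compat; auto. }
  exists (Rmin d 1). split; [apply Rmin_pos; lra|]. intros r hr.
  assert (m1 := Rmin_l d 1). assert (m2 := Rmin_r d 1).
  set (x := 1 - r). assert (hx : 0 < x < d /\ x < 1) by (unfold x; lra).
  specialize (hsm x ltac:(lra)).
  rewrite Rabs_pos_eq by (apply Rmult_le_pos; [left; apply exp_pos | apply log_plus_ge_0]).
  assert (hM : M_infty r h <= / x).
  { apply M_infty_le; [lra|]. intros z hz. eapply Rle_trans; [apply hle|].
    apply Rinv_le_contravar; unfold x; lra. }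
  assert (hlnx : ln x < 0) by (rewrite <- ln_1; apply ln_increasing; lra).
  assert (hL : log_plus (M_infty r h) <= - ln x).
  { eapply Rle_trans; [apply log_plus_le, hM|]. unfold log_plus.
    rewrite ln_Rinv by lra. rewrite Rmax_left; lra. }
  (* [- s ln x = ln (x^(-s)) <= x^(-s)], so [x^(2s) (- ln x) <= x^s / s]. *)
  assert (hexp : - ln x * s <= Rpower x (- s)).
  { unfold Rpower. generalize (exp_ineq1_le (- s * ln x)). lra. }
  assert (e : Rpower x (1 / p) = Rpower x s * Rpower x s).
  { rewrite <- Rpower_plus. f_equal. unfold s. field. lra. }
  assert (e2 : Rpower x s * Rpower x (- s) = 1).
  { rewrite <- Rpower_plus, Rplus_opp_r. apply Rpower_O. lra. }
  assert (hps : 0 < Rpower x s) by apply exp_pos.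
  rewrite e. set (y := Rpower x s) in *. set (y' := Rpower x (- s)) in *.
  apply Rle_lt_trans with (y * y * (- ln x)).
  { apply Rmult_le_compat_l; [nra | exact hL]. }
  apply Rmult_lt_reg_r with s; auto.
  apply Rle_lt_trans with (y * (y * y')).
  - rewrite !Rmult_assoc. repeat (apply Rmult_le_compat_l; [lra|]). exact hexp.
  - rewrite e2, Rmult_1_r. exact hsm.
Qed.

Lemma ex_C_derive_affine (a z : C) : ex_C_derive (fun w => w - a)%C z.
Proof.
  exists (RtoC 1). apply is_C_derive_iff. intros eps heps. exists 1. split; [lra|].
  intros w _. replace (w - a - (z - a) - (w - z) * 1)%C with (RtoC 0) by ring.
  rewrite Cmod_0. apply Rmult_le_pos; [lra | apply Cmod_ge_0].
Qed.

Lemma in_Fp_one (p : R) : 1 < p -> in_Fp p (fun _ => RtoC 1).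
Proof.
  intros hp. apply in_Fp_of_pole_bound; auto.
  - apply (holomorphic_restriction _ (fun _ => RtoC 1)); auto.
    intros z _. apply (@ex_derive_const C_AbsRing C_NormedModule).
  - intros z. rewrite Cmod_1. assert (h := Cmod_disk_val z). assert (h0 := Cmod_ge_0 (disk_val z)).
    rewrite <- Rinv_1 at 1. apply Rinv_le_contravar; lra.
Qed.

Lemma in_Fp_bounded (p B : R) (h : Disk -> C) : 1 < p -> 0 <= B -> holomorphic h ->
  (forall z, Cmod (h z) <= B) -> in_Fp p h.
Proof.
  intros hp hB hh hle. apply (in_Fp_of_affine_bound p B 0 (fun _ => RtoC 1)); auto; try lra.
  - now apply in_Fp_one.
  - intros z. specialize (hle z). lra.
Qed.

Lemma in_Fp_const (p : R) (c : C) : 1 < p -> in_Fp p (fun _ => c).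
Proof.
  intros hp. apply (in_Fp_bounded p (Cmod c)); auto.
  - apply Cmod_ge_0.
  - apply (holomorphic_restriction _ (fun _ => c)); auto.
    intros z _. apply (@ex_derive_const C_AbsRing C_NormedModule).
  - intros _. lra.
Qed.

Lemma in_Fp_affine (p : R) (a : C) : 1 < p -> in_Fp p (fun z => disk_val z - a)%C.
Proof.
  intros hp. apply (in_Fp_bounded p (1 + Cmod a)); auto.
  - generalize (Cmod_ge_0 a); lra.
  - apply (holomorphic_restriction _ (fun z => z - a)%C); auto.
    intros z _. apply ex_C_derive_affine.
  - intros z. unfold Cminus. eapply Rle_trans; [apply Cmod_triangle|].
    rewrite Cmod_opp. assert (h := Cmod_disk_val z). lra.
Qed.

Lemma Cmod_minus_ge (z w : C) : Cmod z - Cmod w <= Cmod (z - w).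
Proof.
  assert (h := Cmod_triangle (z - w) w).
  replace (z - w + w)%C with z in h by ring. lra.
Qed.

(** The case |a| = 1, where the function is unbounded, is included: |z - a| >= |a| - |z| >= 1 -
    |z|. *)
Lemma in_Fp_inv_affine (p : R) (a : C) : 1 < p -> 1 <= Cmod a ->
  in_Fp p (fun z => / (disk_val z - a))%C.
Proof.
  intros hp ha.
  assert (hne : forall z, Cmod z < 1 -> z <> a) by (intros z hz ->; lra).
  apply in_Fp_of_pole_bound; auto.
  - apply (holomorphic_restriction _ (fun z => / (z - a))%C); auto.
    intros z hz. eexists. apply is_C_derive_inv_minus. auto.
  - intros z. assert (h := Cmod_disk_val z).
    assert (hb := Cmod_minus_ge a (disk_val z)).
    rewrite <- (Cmod_opp (a - disk_val z)), Copp_minus_distr in hb.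
    rewrite Cmod_inv by (apply Cmod_gt_0; lra).
    apply Rinv_le_contravar; lra.
Qed.

(** Up to the radius [rho] halfway between |a| and 1 the quotient is bounded by [K]; beyond it |z -
    a| >= d, so it is at most (|f| + |f(a)|) / d. The sum of the two bounds is affine in |f|. *)
Lemma in_Fp_divided_difference (p : R) (f : Disk -> C) (a : Disk) : 1 < p -> in_Fp p f ->
  exists g, in_Fp p g /\ forall z : Disk, (f z = f a + (disk_val z - disk_val a) * g z)%C.
Proof.
  intros hp hf. assert (ha := Cmod_disk_val a).
  destruct (divided_difference (extend f) (disk_val a) ha) as [g [hg hd]].
  { intros z hz. apply holomorphic_extend; auto. apply hf. }
  set (g' := fun z : Disk => g (disk_val z)).
  assert (eg : forall z : Disk, (f z = f a + (disk_val z - disk_val a) * g' z)%C).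
  { intros z. unfold g'. rewrite <- (extend_disk_val f z), <- (extend_disk_val f a). apply hg. }
  exists g'. split; auto.
  assert (hh : holomorphic g') by now apply (holomorphic_restriction _ g).
  set (rho := (1 + Cmod (disk_val a)) / 2). set (d := (1 - Cmod (disk_val a)) / 2).
  assert (ha0 := Cmod_ge_0 (disk_val a)).
  destruct (holomorphic_bounded g' rho hh) as [K hK]; [unfold rho; lra|].
  assert (hd0 : 0 < d) by (unfold d; lra).
  assert (hK0 : 0 <= K).
  { eapply Rle_trans; [apply Cmod_ge_0|]. apply (hK a). unfold rho; lra. }
  assert (hfa := Cmod_ge_0 (f a)).
  assert (hq : 0 <= Cmod (f a) / d) by (apply Rdiv_le_0_compat; lra).
  assert (hinv : 0 < / d) by (apply Rinv_0_lt_compat; lra).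
  apply (in_Fp_of_affine_bound p (K + Cmod (f a) / d) (/ d) f); auto; try lra.
  intros z. assert (hfz := Cmod_ge_0 (f z)).
  assert (hfd : 0 <= / d * Cmod (f z)) by (apply Rmult_le_pos; lra).
  destruct (Rle_dec (Cmod (disk_val z)) rho) as [hz|hz].
  - specialize (hK z hz). lra.
  - assert (hza : d <= Cmod (disk_val z - disk_val a)).
    { eapply Rle_trans; [|apply Cmod_minus_ge]. unfold rho, d in *. lra. }
    assert (hprod : d * Cmod (g' z) <= Cmod (f z) + Cmod (f a)).
    { apply Rle_trans with (Cmod ((disk_val z - disk_val a) * g' z)).
      - rewrite Cmod_mult. apply Rmult_le_compat_r; [apply Cmod_ge_0 | auto].
      - replace ((disk_val z - disk_val a) * g' z)%C with (f z + - f a)%C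
          by (rewrite (eg z); ring).
        eapply Rle_trans; [apply Cmod_triangle|]. rewrite Cmod_opp. lra. }
    apply Rmult_le_compat_l with (r := / d) in hprod; [|lra].
    rewrite <- Rmult_assoc, Rinv_l, Rmult_1_l in hprod by lra.
    unfold Rdiv in *. lra.
Qed.

(** * Multiplicative functionals are evaluations *)

Section MultiplicativeFunctional.

Variables (p : R) (gamma : (Disk -> C) -> C).
Hypothesis hp : 1 < p.
Hypothesis hlin : Fp_linear p gamma.
Hypothesis hmul : Fp_multiplicative p gamma.
Hypothesis hnontriv : exists f, in_Fp p f /\ gamma f <> RtoC 0.

Lemma gamma_one : gamma (fun _ => RtoC 1) = RtoC 1.
Proof.
  destruct hnontriv as [f [hf hne]].
  assert (h := hmul f (fun _ => RtoC 1) hf (in_Fp_one p hp)).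
  replace (fmult f (fun _ => RtoC 1)) with f in h
    by (apply functional_extensionality; intros z; unfold fmult; ring).
  replace (gamma (fun _ => RtoC 1)) with (gamma f * gamma (fun _ => RtoC 1) / gamma f)%C
    by (field; exact hne).
  rewrite <- h. field. exact hne.
Qed.

Lemma gamma_const (c : C) : gamma (fun _ => c) = c.
Proof.
  assert (h := proj2 hlin c (fun _ => RtoC 1) (in_Fp_one p hp)).
  replace (fscal c (fun _ => RtoC 1)) with (fun _ : Disk => c) in h
    by (apply functional_extensionality; intros z; unfold fscal; ring).
  rewrite h, gamma_one. ring.
Qed.

(** The image of the coordinate function, written as z - 0 so that it is an instance of
    [in_Fp_affine]. *)
Let lambda : C := gamma (fun z => disk_val z - 0)%C.

Lemma gamma_affine (a : C) : gamma (fun z => disk_val z - a)%C = (lambda - a)%C.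
Proof.
  assert (h := proj1 hlin (fun z => disk_val z - 0)%C (fun _ => (- a)%C)
    (in_Fp_affine p 0%C hp) (in_Fp_const p (- a)%C hp)).
  replace (fplus (fun z : Disk => disk_val z - 0)%C (fun _ => (- a)%C))
    with (fun z : Disk => disk_val z - a)%C in h
    by (apply functional_extensionality; intros z; unfold fplus; ring).
  rewrite h, gamma_const. reflexivity.
Qed.

Lemma lambda_in_disk : Cmod lambda < 1.
Proof.
  destruct (Rlt_dec (Cmod lambda) 1) as [|hge]; auto. exfalso.
  apply Rnot_lt_le in hge.
  assert (h := hmul _ _ (in_Fp_affine p lambda hp) (in_Fp_inv_affine p lambda hp hge)).
  rewrite gamma_affine in h.
  replace (fmult (fun z : Disk => disk_val z - lambda)%C (fun z : Disk => / (disk_val z - lambda))%C)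
    with (fun _ : Disk => RtoC 1) in h.
  - rewrite gamma_one in h.
    replace ((lambda - lambda) * gamma (fun z : Disk => / (disk_val z - lambda)))%C
      with (RtoC 0) in h by ring.
    apply RtoC_inj in h. lra.
  - apply functional_extensionality. intros z. unfold fmult.
    assert (hz := Cmod_disk_val z).
    assert (hb := Cmod_minus_ge lambda (disk_val z)).
    rewrite <- (Cmod_opp (lambda - disk_val z)), Copp_minus_distr in hb.
    symmetry. apply Cinv_r. apply Cmod_gt_0. lra.
Qed.

Lemma gamma_is_evaluation : exists a : Disk, forall f, in_Fp p f -> gamma f = f a.
Proof.
  set (a := exist _ lambda lambda_in_disk : Disk). exists a. intros f hf.
  destruct (in_Fp_divided_difference p f a hp hf) as [g [hg e]].
  assert (hz := in_Fp_affine p (disk_val a) hp).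
  assert (hm := hmul _ _ hz hg).
  (* [disk_val a] is [lambda] by definition; the occurrence changed is the one outside [gamma], so
     the first factor becomes lambda - lambda. *)
  rewrite gamma_affine in hm. change (disk_val a) with lambda in hm at 2.
  (* Additivity of [gamma] asks for this product in F^p; it equals f - f(a), to which the affine
     bound applies. *)
  assert (hfa : in_Fp p (fmult (fun z => disk_val z - disk_val a)%C g)).
  { apply (in_Fp_of_affine_bound p (Cmod (f a)) 1 f); auto; try lra.
    - apply Cmod_ge_0.
    - apply (holomorphic_restriction _ (fun z => extend f z - f a)%C).
      + intros z. rewrite extend_disk_val, (e z). unfold fmult. ring.
      + intros z hzz. apply ex_C_derive_minus_const.
        apply holomorphic_extend; auto. apply hf.
    - intros z. unfold fmult.
      replace ((disk_val z - disk_val a) * g z)%C with (- f a + f z)%C by (rewrite (e z); ring).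
      eapply Rle_trans; [apply Cmod_triangle|]. rewrite Cmod_opp. lra. }
  assert (h := proj1 hlin _ _ (in_Fp_const p (f a) hp) hfa).
  rewrite hm, gamma_const in h.
  replace (fplus (fun _ : Disk => f a) (fmult (fun z => disk_val z - disk_val a)%C g)) with f in h.
  - rewrite h. ring.
  - apply functional_extensionality. intros z. unfold fplus, fmult. apply e.
Qed.

End MultiplicativeFunctional.

(** * Continuity of point evaluations *)

Lemma pow_le_exp_nat_rpow (x s : R) : 0 <= x < 1 -> 0 < s <= 1 ->
  exists c, 0 < c /\ forall n, x ^ n <= exp (- c * nat_rpow n s).
Proof.
  intros hx hs.
  destruct (Req_dec x 0) as [->|hne].
  (* At x = 0 any c would do: the powers vanish for n > 0, and for n = 0 both sides are 1 because
     [nat_rpow 0 s] is 0. *)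
  - exists 1. split; [lra|]. intros [|n]; simpl.
    + rewrite Rmult_0_r, exp_0. lra.
    + rewrite Rmult_0_l. left; apply exp_pos.
  - assert (hln : ln x < 0) by (rewrite <- ln_1; apply ln_increasing; lra).
    (* Since n^s <= n for n >= 1 and s <= 1, x^n = exp (n ln x) <= exp (n^s ln x). *)
    exists (- ln x). split; [lra|]. intros [|n].
    + simpl. rewrite Rmult_0_r, exp_0. lra.
    + rewrite <- (Rpower_pow (S n) x) by lra. unfold Rpower at 1.
      assert (hle : nat_rpow (S n) s <= INR (S n)).
      { unfold nat_rpow. rewrite <- (Rpower_1 (INR (S n))) at 2 by (apply lt_0_INR; lia).
        apply Rle_Rpower; [|lra]. rewrite S_INR. generalize (pos_INR n). lra. }
      set (y := nat_rpow (S n) s) in *.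
      assert (hm : INR (S n) * ln x <= - - ln x * y) by nra.
      destruct hm as [hm| ->]; [|lra]. left; now apply exp_increasing.
Qed.

(** The Taylor series at [a] is dominated termwise by the series of the seminorm, once |a|^n is
    below the weight exp (-c n^(1/(p+1))). *)
Lemma Cmod_le_seminorm (p : R) (a : Disk) : 1 < p ->
  exists c, 0 < c /\ forall h delta, holomorphic h ->
    Rbar_lt (seminorm p c h) (Finite delta) -> Cmod (h a) < delta.
Proof.
  intros hp. assert (ha := Cmod_disk_val a).
  destruct (pow_le_exp_nat_rpow (Cmod (disk_val a)) (1 / (p + 1))) as [c [hc hle]].
  { split; [apply Cmod_ge_0 | auto]. }
  { split; [apply Rdiv_lt_0_compat; lra|].
    apply Rmult_le_reg_r with (p + 1); [lra|].
    replace (1 / (p + 1) * (p + 1)) with 1 by (field; lra). lra. }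
  exists c. split; auto. intros h delta hh hlt. unfold seminorm in hlt.
  set (u := fun n => Cmod (taylor h n) * exp (- c * nat_rpow n (1 / (p + 1)))) in hlt.
  assert (hu : forall n, 0 <= u n).
  { intros n. apply Rmult_le_pos; [apply Cmod_ge_0 | left; apply exp_pos]. }
  assert (hinc : forall n, sum_n u n <= sum_n u (S n)).
  { intros n. rewrite sum_Sn. unfold plus; simpl. specialize (hu (S n)). lra. }
  (* [Lim_seq] has a value for every sequence; monotonicity makes it a genuine limit, possibly
     +oo. *)
  assert (hlim : is_lim_seq (sum_n u) (Lim_seq (sum_n u)))
    by (apply Lim_seq_correct, ex_lim_seq_incr, hinc).
  assert (hub : forall N, Rbar_le (sum_n u N) (Lim_seq (sum_n u))).
  { intros N. apply (is_lim_seq_le_loc (fun _ => sum_n u N) (sum_n u)); auto.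
    - exists N. intros n hn. induction hn as [|n hn IH]; [lra|]. specialize (hinc n). lra.
    - apply is_lim_seq_const. }
  (* The assumed bound by [delta] excludes +oo, the partial sums exclude -oo. *)
  destruct (Lim_seq (sum_n u)) as [l| |]; simpl in hlt; try contradiction.
  - apply Rle_lt_trans with l; auto.
    apply (Cmod_lim_le _ _ _ (power_expansion_taylor h hh a)). intros N.
    eapply Rle_trans; [|apply (hub N)].
    induction N as [|N IH].
    + rewrite !sum_O. unfold u.
      change (Cmod (disk_val a ^ 0 * taylor h 0) <=
        Cmod (taylor h 0) * exp (- c * nat_rpow 0 (1 / (p + 1)))).
      rewrite Cmod_mult, Cmod_pow, Rmult_comm.
      apply Rmult_le_compat_l; [apply Cmod_ge_0 | apply hle].
    + rewrite !sum_Sn. eapply Rle_trans; [apply Cmod_triangle|].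
      apply Rplus_le_compat; [exact IH|]. unfold u.
      change (Cmod (disk_val a ^ S N * taylor h (S N)) <=
        Cmod (taylor h (S N)) * exp (- c * nat_rpow (S N) (1 / (p + 1)))).
      rewrite Cmod_mult, Cmod_pow, Rmult_comm.
      apply Rmult_le_compat_l; [apply Cmod_ge_0 | apply hle].
  - contradiction (hub 0%nat).
Qed.

Theorem theorem7 (p : R) (hp : 1 < p) (gamma : (Disk -> C) -> C)
    (hlin : Fp_linear p gamma)
    (hmul : Fp_multiplicative p gamma)
    (hnontriv : exists f, in_Fp p f /\ gamma f <> RtoC 0) :
  (exists lambda : Disk, forall f, in_Fp p f -> gamma f = f lambda) /\
  Fp_continuous p gamma.
Proof.
  destruct (gamma_is_evaluation p gamma hp hlin hmul hnontriv) as [a ha].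
  split; [now exists a|].
  intros V hV f hf hVf.
  destruct (Cmod_le_seminorm p a hp) as [c [hc hle]].
  destruct (hV _ hVf) as [eps heps].
  (* One seminorm suffices: it dominates evaluation at [a], and [eps] is the radius of a ball inside
     [V]. *)
  exists (c :: nil), eps. split; [|split].
  - intros c' [<-|[]]. exact hc.
  - apply cond_pos.
  - intros g hg hlt. apply heps.
    apply (@norm_compat1 C_AbsRing C_NormedModule).
    change (Cmod (gamma g - gamma f) < eps).
    rewrite (ha g hg), (ha f hf).
    apply (hle (fminus g f)).
    + apply holomorphic_fminus; [apply hg | apply hf].
    + apply hlt. now left.
Qed.
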